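(* Let $m\ge 2$ and consider $\mathbb{C}^m\setminus\{0\}$ with the $U(m)$-invariant Kähler metric $\omega=\sqrt{-1}\,\partial\bar\partial f(S)$, where $S=\sum_{i=1}^m|z_i|^2$, $f(S)=\log S+g(S)$, and $g$ is a real-analytic function of $S\in[0,\infty)$ satisfying $$g_S(0)>0,\qquad \frac1S+g_S>0,\qquad g_S+S g_{SS}>0$$ (the last two inequalities for all $S>0$). Then there exists $\epsilon>0$ such that, for every $R_0$ with $0<R_0<\epsilon$, the mean curvature flow with initial condition the hypersphere $\Sigma_{R_0}=\{z\in\mathbb{C}^m: |z|=R_0\}$ converges, at a finite time $T$, to the exceptional divisor $E$ of $Bl_0\mathbb{C}^m$, and the flow has a singularity of Type I at time $T$.
   Context: Subscripts $S$ denote derivatives with respect to $S$ (so $g_S=g'(S)$, $g_{SS}=g''(S)$). The Riemannian metric associated with $\omega=\sqrt{-1}\,\partial\bar\partial f(S)$ is the one whose Hermitian matrix is $\big(f_S\delta_{ij}+f_{SS}\bar z_i z_j\big)_{i,j}$, normalized so that $f(S)=S$ gives the Euclidean metric. $Bl_0\mathbb{C}^m=\{(z,[t])\in\mathbb{C}^m\times\mathbb{CP}^{m-1}: z_it_j-z_jt_i=0 \text{ for all } i,j\}$, with projection $\pi_1:Bl_0\mathbb{C}^m\to\mathbb{C}^m$, $\pi_1(z,[t])=z$. The exceptional divisor is $E=\pi_1^{-1}(0)\cong\mathbb{CP}^{m-1}$, and $\pi_1$ restricts to a biholomorphism $Bl_0\mathbb{C}^m\setminus E\to\mathbb{C}^m\setminus\{0\}$,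 by which hypersurfaces of $\mathbb{C}^m\setminus\{0\}$ are regarded as hypersurfaces of $Bl_0\mathbb{C}^m$. Under the conditions $g_S(0)>0$, and $\frac1S+g_S>0$, $g_S+S g_{SS}>0$ for all $S>0$, $\pi_1^*\omega$ extends to a Kähler metric on $Bl_0\mathbb{C}^m$. Mean curvature flow of an immersion $F_0:\Sigma\to M$ of a hypersurface into a Riemannian manifold is a smooth family $F_t=F(\cdot,t):\Sigma\to M$, $t\in[0,T)$, with $\frac{\partial}{\partial t}F(p,t)=H(p,t)\,n(p,t)$ and $F(\cdot,0)=F_0$, where $n(p,t)$ is a unit normal and $H(p,t)$ the mean curvature of $F_t$ with respect to $n(p,t)$. Here the second fundamental form is $\Pi_n(X,X)=g(\nabla_XX,n)$ ($g$ denoting the ambient Riemannian metric), and $H$ is the arithmetic mean of its eigenvalues (the principal curvatures), i.e. their sum divided by $2m-1$. By symmetry, the flow starting from $\Sigma_{R_0}$ consists of hyperspheres $\Sigma_{R(t)}=\{|z|=R(t)\}$, and it converges to the exceptional divisor at time $T$ when $R(t)\to0$ as $t\to T$. $|A|^2$ denotes the squared norm of the second fundamental form. A time $T$ is a singular time if $|A|^2$ blows up as $t\to T$. The singularity at $T$ is of Type I if there is a constant $C>1$ with $\max_{p\in\Sigma}|A(p,t)|^2\le \frac{C}{T-t}$ for $t\in[0,T)$. *)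

(* Defs.v *)
From HB Require Import structures.
From mathcomp Require Import all_boot all_order all_algebra.
From mathcomp Require Import complex.
From mathcomp Require Import all_classical all_reals all_analysis.

Set Implicit Arguments.
Unset Strict Implicit.
Unset Printing Implicit Defensive.

Import Order.TTheory GRing.Theory Num.Theory.
Import numFieldNormedType.Exports.

Local Open Scope ring_scope.
Local Open Scope classical_set_scope.
Local Open Scope complex_scope.

Section Analytic.
Context {R : realType}.

(* Real-analyticity on the closed half-line [0, +oo[ is understood, as usual,
   as real-analyticity on a neighbourhood of it: the expansion at each point,
   0 included, holds on a two-sided interval.  In particular the two-sided
   derivatives g^`() 0, g^`(2) 0 are the ones of the function on [0, +oo[. *)
Definition real_analytic_nonneg (g : R -> R) : Prop :=
  forall x0 : R, 0 <= x0 ->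
    exists (a : R^nat) (r : R), 0 < r /\
      forall x, `|x - x0| < r -> pseries a (x - x0) @ \oo --> g x.

End Analytic.

Section Smooth.
Context {R : realType} {V W : normedModType R}.

Definition iter_derive (h : V -> W) (vs : seq V) : V -> W :=
  foldr (fun v k => 'D_v k) h vs.

(* C^oo on the open set U: all iterated directional derivatives exist and are
   continuous on U. *)
Definition smooth_on (U : set V) (h : V -> W) : Prop :=
  forall (vs : seq V) (x : V), U x ->
    {for x, continuous (iter_derive h vs)} /\
    (forall v : V, derivable (iter_derive h vs) x v).

End Smooth.

Section Space.
Context {R : realType} {m : nat}.

(* C^m is the real vector space R^(m+m): the first m coordinates of a vector
   are the real parts of z_1, ..., z_m, the last m are the imaginary parts. *)
Local Notation V := 'rV[R]_(m + m).
Implicit Types (x v w z : V) (f : R -> R).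

Definition zcoord z (j : 'I_m) : R[i] :=
  z 0 (lshift m j) +i* z 0 (rshift m j).

Definition edot v w : R := \sum_k v 0 k * w 0 k.
Definition radius2 z : R := edot z z.
Definition enorm z : R := Num.sqrt (radius2 z).

Definition hypersphere (r : R) : set V := [set z | enorm z = r].

(* The Riemannian metric of sqrt(-1) ddbar f(S), S = radius2 z, normalized so
   that f(S) = S gives the Euclidean metric. *)
Definition kahler_matrix f z : 'M[R[i]]_m :=
  \matrix_(i, j) ((f^`()%classic (radius2 z))%:C * (i == j)%:R
    + (f^`(2)%classic (radius2 z))%:C * (zcoord z i)^*%C * zcoord z j).

Definition metric f z v w : R :=
  complex.Re (\sum_i \sum_j
    kahler_matrix f z i j * zcoord v i * (zcoord w j)^*%C).

(* Levi-Civita connection of [metric f] in the real coordinates of V. *)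
Definition basis_vec (k : 'I_(m + m)) : V := delta_mx 0 k.

Definition metric_matrix f z : 'M[R]_(m + m) :=
  \matrix_(k, l) metric f z (basis_vec k) (basis_vec l).

Definition dmetric f z (k i j : 'I_(m + m)) : R :=
  'D_(basis_vec k) (fun y : V => metric_matrix f y i j) z.

Definition christoffel f z (k i j : 'I_(m + m)) : R :=
  2^-1 * \sum_l invmx (metric_matrix f z) k l *
    (dmetric f z i j l + dmetric f z j i l - dmetric f z l i j).

Definition christoffel_form f z v w : V :=
  \row_k \sum_i \sum_j christoffel f z k i j * v 0 i * w 0 j.

(* Families of immersions of the hypersphere [hypersphere R0] into C^m \ {0}.
   Only the values F p t with p on the sphere matter: all derivatives are those
   of the extension of F that is constant along rays.  If p is on the sphere
   and v is tangent to it at p, then 'D_v (ray_ext R0 F t) p is the image of v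
   under the differential of F(., t). *)
Definition ray_ext (R0 : R) (F : V -> R -> V) (t : R) : V -> V :=
  fun x => F ((R0 / enorm x) *: x) t.

Definition tangent (p v : V) : Prop := edot p v = 0.

Definition differential (R0 : R) (F : V -> R -> V) (t : R) (p v : V) : V :=
  'D_v (ray_ext R0 F t) p.

Definition unit_normal f R0 (F : V -> R -> V) (t : R) (p n : V) : Prop :=
  metric f (F p t) n n = 1 /\
  forall v, tangent p v -> metric f (F p t) (differential R0 F t p v) n = 0.

(* Pi_n(X, Y) = metric(nabla_X Y, n) for X = dF(v), Y = dF(w).  Here w is
   extended to the tangent field on the sphere obtained by projecting the
   constant field w, so that nabla_X Y is the sum of the second derivative of
   the ray-constant extension and of the Christoffel term. *)
Definition second_fundamental_form f R0 (F : V -> R -> V) (t : R)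
    (p n v w : V) : R :=
  metric f (F p t)
    ('D_v ('D_w (ray_ext R0 F t)) p
       + christoffel_form f (F p t)
           (differential R0 F t p v) (differential R0 F t p w))
    n.

(* Basis of the tangent space at p, orthonormal for the metric induced by
   F(., t); the hypersurface has dimension 2m-1. *)
Definition orthonormal_frame f R0 (F : V -> R -> V) (t : R) (p : V)
    (e : 'I_(m + m).-1 -> V) : Prop :=
  (forall a, tangent p (e a)) /\
  forall a b, metric f (F p t)
    (differential R0 F t p (e a)) (differential R0 F t p (e b)) = (a == b)%:R.

(* The eigenvalues, with multiplicity, of the second fundamental form relative
   to the induced metric. *)
Definition principal_curvatures f R0 (F : V -> R -> V) (t : R) (p n : V)
    (kappa : 'I_(m + m).-1 -> R) : Prop :=
  exists e, orthonormal_frame f R0 F t p e /\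
    forall a b, second_fundamental_form f R0 F t p n (e a) (e b)
                = kappa a *+ (a == b).

Definition mean_curvature f R0 (F : V -> R -> V) (t : R) (p n : V)
    (H : R) : Prop :=
  exists kappa, principal_curvatures f R0 F t p n kappa /\
    H = (\sum_a kappa a) / (m + m).-1%:R.

(* A2 is the value of |A|^2 at (p, t). *)
Definition sff_norm2 f R0 (F : V -> R -> V) (t : R) (p : V) (A2 : R) : Prop :=
  exists n e, [/\ unit_normal f R0 F t p n,
    orthonormal_frame f R0 F t p e &
    A2 = \sum_a \sum_b
           second_fundamental_form f R0 F t p n (e a) (e b) ^+ 2].

(* Mean curvature flow in C^m \ {0} on the time interval [0, T[, starting from
   the inclusion of [hypersphere R0].  Smoothness on the manifold with boundary
   [hypersphere R0] x [0, T[ means that F extends smoothly to slightly negative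
   times; the values of F at these times are not otherwise constrained. *)
Definition mean_curvature_flow f (R0 T : R) (F : V -> R -> V) : Prop :=
  [/\ 0 < T,
      exists2 delta : R, 0 < delta &
        smooth_on [set xt : V * R | xt.1 != 0 /\ - delta < xt.2 < T]
          (fun xt : V * R => ray_ext R0 F xt.2 xt.1),
      forall p, hypersphere R0 p -> F p 0 = p,
      forall p t, hypersphere R0 p -> 0 <= t < T ->
        F p t != 0 /\
        forall v, tangent p v -> v != 0 -> differential R0 F t p v != 0 &
      exists (n : V -> R -> V) (H : V -> R -> R),
        forall p t, hypersphere R0 p -> 0 <= t < T ->
          [/\ unit_normal f R0 F t p (n p t),
              mean_curvature f R0 F t p (n p t) (H p t) &
              (F p)^`()%classic t = H p t *: n p t]].

(* The blow-up of C^m at 0: a point (z, [w]) is given by z and by homogeneous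
   coordinates w != 0 of a point [w] of CP^(m-1). *)
Definition Bl0 : set (V * V) :=
  [set P | P.2 != 0 /\
     forall i j, zcoord P.1 i * zcoord P.2 j - zcoord P.1 j * zcoord P.2 i = 0].

Definition exceptional_divisor : set (V * V) := [set P | Bl0 P /\ P.1 = 0].

Definition preimage_Bl0 (A : set V) : set (V * V) := [set P | Bl0 P /\ A P.1].

Definition hdot v w : R[i] := \sum_j zcoord v j * (zcoord w j)^*%C.

(* The distance sqrt(1 - |<w,w'>|^2 / (|w|^2 |w'|^2)) on CP^(m-1), i.e. the
   sine of the angle between two complex lines. *)
Definition proj_dist v w : R :=
  Num.sqrt (1 - (complex.Re (hdot v w) ^+ 2 + complex.Im (hdot v w) ^+ 2)
                / (radius2 v * radius2 w)).

Definition Bl0_dist (P Q : V * V) : R :=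
  enorm (P.1 - Q.1) + proj_dist P.2 Q.2.

(* The hypersurfaces F_t are hyperspheres whose radius tends to 0 as t -> T;
   as subsets of the blow-up they converge to the exceptional divisor in the
   Hausdorff sense. *)
Definition converges_to_exceptional_divisor (R0 T : R) (F : V -> R -> V) :
    Prop :=
  (exists rho : R -> R,
     (forall t, 0 <= t < T ->
        0 < rho t /\ (fun p => F p t) @` hypersphere R0 = hypersphere (rho t)) /\
     rho t @[t --> T^'-] --> (0 : R)) /\
  (forall eps : R, 0 < eps -> \forall t \near T^'-,
     let Sigma_t := preimage_Bl0 ((fun p => F p t) @` hypersphere R0) in
     (forall P, Sigma_t P ->
        exists2 Q, exceptional_divisor Q & Bl0_dist P Q < eps) /\
     (forall Q, exceptional_divisor Q ->
        exists2 P, Sigma_t P & Bl0_dist P Q < eps)).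

Definition singular_time f (R0 T : R) (F : V -> R -> V) : Prop :=
  forall K : R, \forall t \near T^'-,
    exists p A2, [/\ hypersphere R0 p, sff_norm2 f R0 F t p A2 & K <= A2].

Definition type_I f (R0 T : R) (F : V -> R -> V) : Prop :=
  exists2 C : R, 1 < C &
    forall t p A2, 0 <= t < T -> hypersphere R0 p ->
      sff_norm2 f R0 F t p A2 -> A2 <= C / (T - t).

End Space.

(* Main.v *)
(* In the metric of f(S), with S = |z|^2, the vector z and the line spanned by
   iz are eigendirections with eigenvalue b = (S f')', and their orthogonal
   complement has eigenvalue a = f'.  Hence the sphere of squared radius S has
   principal curvatures proportional to b/a (2m-2 times) and 1 + S b'/b (once,
   along iz), with common factor -1/sqrt(S b), and mean curvature flow of
   spheres is the scalar equation S' = -psi(S).  As S a = 1 + S g' and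
   b = g' + S g'', the function psi is continuous and positive at S = 0: S
   vanishes linearly at a finite time T, while S |A|^2 tends to 1/g'(0), which
   is a type I singularity.

   For uniqueness among all flows, not only the spherically symmetric ones, at a
   point where |F(., t)|^2 is maximal or minimal the hypersurface is tangent to a
   centred sphere and the second derivative test compares the two mean
   curvatures.  Time-changed solutions of the scalar equation are therefore
   strict barriers, which forces |F(., t)|^2 = S(t); the velocity, being normal,
   is then radial and F/|F| is constant in time.  *)

Require Import Defs.
From HB Require Import structures.
From mathcomp Require Import all_boot all_order all_algebra.
From mathcomp Require Import complex.
From mathcomp Require Import all_classical all_reals all_analysis.
From mathcomp Require Import ring lra.

Set Implicit Arguments.
Unset Strict Implicit.
Unset Printing Implicit Defensive.

Import Order.TTheory GRing.Theory Num.Theory.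
Import numFieldNormedType.Exports.

Local Open Scope ring_scope.
Local Open Scope classical_set_scope.

(** * Linear algebra of C^m as a real Euclidean space *)

(** Curvature is only ever computed at points where the tangent space is Euclidean-orthogonal to the
    position vector. There the unit normal is radial, and the second derivatives of F can be traded
    for the Hessian of |F|^2. One formula then serves twice: for the spheres the Hessian vanishes,
    which gives their curvature, and at an extremal point of |F|^2 it has a sign, which gives the
    comparison for an arbitrary flow.

    The potential is singular at S = 0, so everything is rewritten in S f' and (S f')', which extend
    across 0. The scalar equation is therefore solved on a time interval reaching beyond T, and the
    linear vanishing of S is the mean value theorem on [t, T]. The bound on R0 keeps S where psi and
    S |A|^2 stay close to their positive values at 0.

    The barriers are made strict by changing the speed of time: positivity of psi takes the place of
    a Lipschitz estimate. A sign eps = 1 or -1 is carried along so that maxima and minima, upper and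
    lower barriers, share their proofs. *)

Section EuclideanAlgebra.
Context {R : realType} {m : nat}.
Local Notation V := 'rV[R]_(m + m).
Implicit Types (u v w x z : V) (c : R).

Lemma edotC v w : edot v w = edot w v.
Proof. by apply: eq_bigr => k _; rewrite mulrC. Qed.

Lemma edotDl u v w : edot (u + v) w = edot u w + edot v w.
Proof. by rewrite -big_split; apply: eq_bigr => k _; rewrite mxE mulrDl. Qed.

Lemma edotZl c v w : edot (c *: v) w = c * edot v w.
Proof. by rewrite mulr_sumr; apply: eq_bigr => k _; rewrite mxE mulrA. Qed.

Lemma edotDr u v w : edot w (u + v) = edot w u + edot w v.
Proof. by rewrite edotC edotDl !(edotC w). Qed.

Lemma edotZr c v w : edot w (c *: v) = c * edot w v.
Proof. by rewrite edotC edotZl (edotC w). Qed.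

Lemma edotNl v w : edot (- v) w = - edot v w.
Proof. by rewrite -scaleN1r edotZl mulN1r. Qed.

Lemma edotNr v w : edot w (- v) = - edot w v.
Proof. by rewrite edotC edotNl (edotC w). Qed.

Lemma edotBl u v w : edot (u - v) w = edot u w - edot v w.
Proof. by rewrite edotDl edotNl. Qed.

Lemma edotBr u v w : edot w (u - v) = edot w u - edot w v.
Proof. by rewrite edotDr edotNr. Qed.

Lemma edot0l v : edot 0 v = 0.
Proof. by apply: big1 => k _; rewrite mxE mul0r. Qed.

Lemma edot_basis k v : edot (basis_vec k) v = v 0 k.
Proof.
rewrite /edot (bigD1 k) //= big1 ?addr0 => [|l lk]; rewrite mxE eqxx /=.
  by rewrite eqxx mul1r.
by rewrite (negbTE lk) mul0r.
Qed.

Lemma radius2_ge0 z : 0 <= radius2 z.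
Proof. by apply: sumr_ge0 => k _; rewrite -expr2 sqr_ge0. Qed.

Lemma radius2_eq0 z : (radius2 z == 0) = (z == 0).
Proof.
apply/eqP/eqP => [z0|->]; last exact: edot0l.
apply/rowP => k; rewrite mxE; apply/eqP; rewrite -sqrf_eq0 expr2.
by move/eqP: z0; rewrite psumr_eq0 => [/allP/(_ k (mem_index_enum k))//|l _];
  rewrite -expr2 sqr_ge0.
Qed.

Lemma radius2_gt0 z : (0 < radius2 z) = (z != 0).
Proof. by rewrite lt_def radius2_ge0 andbT radius2_eq0. Qed.

Lemma radius2Z c z : radius2 (c *: z) = c ^+ 2 * radius2 z.
Proof. by rewrite /radius2 edotZl edotZr mulrA expr2. Qed.

Lemma enorm_ge0 z : 0 <= enorm z.
Proof. exact: sqrtr_ge0. Qed.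

Lemma sqr_enorm z : enorm z ^+ 2 = radius2 z.
Proof. by rewrite sqr_sqrtr ?radius2_ge0. Qed.

Lemma enorm_gt0 z : (0 < enorm z) = (z != 0).
Proof. by rewrite sqrtr_gt0 radius2_gt0. Qed.

Lemma enorm_eq0 z : (enorm z == 0) = (z == 0).
Proof. by rewrite -sqrf_eq0 sqr_enorm radius2_eq0. Qed.

Lemma enormZ c z : enorm (c *: z) = `|c| * enorm z.
Proof. by rewrite /enorm radius2Z sqrtrM ?sqr_ge0 // sqrtr_sqr. Qed.

(** Multiplication by i in the real coordinates of C^m. *)
Definition Jmul z : V := row_mx (- rsubmx z) (lsubmx z).

Lemma Jmul_l z j : Jmul z 0 (lshift m j) = - z 0 (rshift m j).
Proof. by rewrite row_mxEl !mxE. Qed.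

Lemma Jmul_r z j : Jmul z 0 (rshift m j) = z 0 (lshift m j).
Proof. by rewrite row_mxEr !mxE. Qed.

Lemma edot_split v w : edot v w =
  \sum_(j < m) (v 0 (lshift m j) * w 0 (lshift m j)
                + v 0 (rshift m j) * w 0 (rshift m j)).
Proof. by rewrite /edot big_split_ord /= big_split. Qed.

Lemma edot_Jmul v w : edot v (Jmul w) = - edot w (Jmul v).
Proof.
rewrite !edot_split -sumrN; apply: eq_bigr => j _.
by rewrite !Jmul_l !Jmul_r; ring.
Qed.

Lemma edot_JmulJmul v w : edot (Jmul v) (Jmul w) = edot v w.
Proof.
rewrite !edot_split; apply: eq_bigr => j _.
by rewrite !Jmul_l !Jmul_r; ring.
Qed.

Lemma edot_Jmul0 v : edot v (Jmul v) = 0.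
Proof.
have /eqP := edot_Jmul v v; rewrite -subr_eq0 opprK -mulr2n.
by rewrite mulrn_eq0 /= => /eqP.
Qed.

Lemma JmulD v w : Jmul (v + w) = Jmul v + Jmul w.
Proof.
apply/rowP => k; rewrite [RHS]mxE; case: (split_ordP k) => j ->.
  by rewrite !Jmul_l mxE opprD.
by rewrite !Jmul_r mxE.
Qed.

Lemma JmulZ c v : Jmul (c *: v) = c *: Jmul v.
Proof.
apply/rowP => k; rewrite [RHS]mxE; case: (split_ordP k) => j ->.
  by rewrite !Jmul_l mxE mulrN.
by rewrite !Jmul_r mxE.
Qed.

Lemma row_basisE v : v = \sum_k v 0 k *: basis_vec k.
Proof. exact: row_sum_delta. Qed.

(** Collapses a coordinate sum into one value of a linear functional; this is how matrix entries and
    Christoffel symbols become coordinate-free formulas. *)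
Lemma sum_scalar (phi : V -> R) v :
    (forall x y, phi (x + y) = phi x + phi y) ->
    (forall c x, phi (c *: x) = c * phi x) ->
  \sum_k v 0 k * phi (basis_vec k) = phi v.
Proof.
move=> phiD phiZ; have phi0 : phi 0 = 0 by rewrite -(scale0r 0) phiZ mul0r.
rewrite [in RHS](row_basisE v) (big_morph phi phiD phi0).
by apply: eq_bigr => k _; rewrite phiZ.
Qed.

(* Orthonormal families extend because a matrix with fewer rows than columns
   has a nonzero kernel. *)
Lemma orthonormal_extension (k : nat) (E : 'I_k -> V) : (k < m + m)%N ->
    (forall a b, edot (E a) (E b) = (a == b)%:R) ->
  exists v, edot v v = 1 /\ forall a, edot (E a) v = 0.
Proof.
move=> km EE; pose A : 'M[R]_(m + m, k) := \matrix_(i, a) E a 0 i.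
have /rowV0Pn[x xA x0] : kermx A != 0.
  rewrite -mxrank_eq0 mxrank_ker subn_eq0 -ltnNge.
  by apply: leq_ltn_trans km; exact: rank_leq_col.
move/sub_kermxP: xA => xA.
exists ((enorm x)^-1 *: x); split.
  rewrite -[edot _ _]/(radius2 _) radius2Z -sqr_enorm -exprMn.
  by rewrite mulVf ?expr1n // enorm_eq0.
move=> a; rewrite edotZr; have /rowP/(_ a) := xA; rewrite !mxE => xAa.
rewrite edotC [edot _ _](_ : _ = 0) ?mulr0 // -[RHS]xAa.
by apply: eq_bigr => i _; rewrite mxE.
Qed.

Lemma orthonormal_completion (j k : nat) (E : 'I_j -> V) : (j + k <= m + m)%N ->
    (forall a b, edot (E a) (E b) = (a == b)%:R) ->
  exists E' : 'I_(j + k) -> V, (forall a, E' (lshift k a) = E a) /\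
    forall a b, edot (E' a) (E' b) = (a == b)%:R.
Proof.
elim: k j E => [|k IHk] j E jk EE.
  exists (fun a => E (cast_ord (addn0 j) a)); split=> [a|a b].
    by congr E; apply: val_inj.
  by rewrite EE -(inj_eq (@cast_ord_inj _ _ (addn0 j))).
have [||v [vv Ev]] := @orthonormal_extension j E; rewrite ?EE //.
  by apply: leq_trans jk; rewrite addnS leq_addr.
pose E1 (a : 'I_(j + 1)) := match fintype.split a with inl b => E b | inr _ => v end.
have E1l a : E1 (lshift 1 a) = E a by rewrite /E1 (unsplitK (inl a)).
have E1r a : E1 (rshift j a) = v by rewrite /E1 (unsplitK (inr a)).
have [||E' [E'l E'E']] := IHk (j + 1)%N E1; first by rewrite -addnA.
  move=> a b; case: (split_ordP a) => a' ->; case: (split_ordP b) => b' ->.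
  - by rewrite !E1l EE (inj_eq (@lshift_inj _ _)).
  - by rewrite E1l E1r Ev eq_lrshift.
  - by rewrite E1l E1r edotC Ev eq_rlshift.
  - by rewrite !E1r vv !ord1 eqxx.
have e : (j + k.+1 = j + 1 + k)%N by rewrite -addnA.
exists (fun a => E' (cast_ord e a)); split=> [a|a b].
  by rewrite -E1l -E'l; congr E'; apply: val_inj.
by rewrite E'E' -(inj_eq (@cast_ord_inj _ _ e)).
Qed.

End EuclideanAlgebra.

(** Stack N and the X i as rows of a square matrix C. Orthonormality says C G C^T = 1, and a
    one-sided inverse of a square matrix is two-sided, so G C^T C = 1; inserting this into u G w^T
    gives the expansion. *)
Lemma parseval (R : realType) (k : nat) (G : 'M[R]_k.+1)
    (b : 'rV[R]_k.+1 -> 'rV[R]_k.+1 -> R)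
    (X : 'I_k -> 'rV[R]_k.+1) (N u w : 'rV[R]_k.+1) :
  (forall x y, b x y = (x *m G *m y^T) 0 0) ->
  (forall i j, b (X i) (X j) = (i == j)%:R) ->
  (forall i, b (X i) N = 0) -> (forall i, b N (X i) = 0) -> b N N = 1 ->
  \sum_i b u (X i) * b (X i) w + b u N * b N w = b u w.
Proof.
move=> bE XX XN NX NN.
pose C : 'M[R]_k.+1 := \matrix_i (if unlift ord0 i is Some j then X j else N).
have C0 : row ord0 C = N by rewrite rowK unlift_none.
have CS i : row (lift ord0 i) C = X i by rewrite rowK liftK.
have bC i j : (C *m G *m C^T) i j = b (row i C) (row j C).
  rewrite bE tr_row -row_mul [LHS]mxE [RHS]mxE; apply: eq_bigr => l _.
  by rewrite [row _ _ _ _]mxE [col _ _ _ _]mxE.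
have CC : C *m (G *m C^T) = 1%:M.
  rewrite mulmxA; apply/matrixP => i j; rewrite bC mxE.
  case: (unliftP ord0 i) => [i'|] ->; case: (unliftP ord0 j) => [j'|] ->.
  - by rewrite !CS XX (inj_eq lift_inj).
  - by rewrite CS C0 XN.
  - by rewrite CS C0 NX.
  - by rewrite C0 NN.
have CC' := mulmx1C CC.
have -> : b u w = (u *m (G *m C^T) *m (C *m G *m w^T)) 0 0.
  by rewrite bE -!mulmxA (mulmxA (C^T)) (mulmxA G (C^T *m C)) (mulmxA G C^T) CC' mul1mx.
rewrite mxE big_ord_recl addrC.
have h1 i : (u *m (G *m C^T)) 0 i = b u (row i C).
  rewrite bE tr_row mulmxA [LHS]mxE [RHS]mxE; apply: eq_bigr => l _.
  by rewrite [col _ _ _ _]mxE.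
have h2 i : (C *m G *m w^T) i 0 = b (row i C) w.
  by rewrite bE -!row_mul [RHS]mxE.
rewrite h1 h2 C0; congr (_ + _); apply: eq_bigr => i _.
by rewrite h1 h2 CS.
Qed.

(** * The metric and its Levi-Civita connection *)

Section MetricAlgebra.
Context {R : realType} {m : nat}.
Local Notation V := 'rV[R]_(m + m).
Implicit Types (u v w x z : V) (a : R) (f : R -> R).

Lemma hdotE v w : hdot v w = Complex (edot v w) (edot v (Jmul w)).
Proof.
rewrite /hdot !edot_split.
elim/big_rec3: _ => [|j y1 y2 y3 _ ->] //=.
rewrite Jmul_l Jmul_r /zcoord; apply/eqP; rewrite eq_complex /=.
by apply/andP; split; apply/eqP; ring.
Qed.

(** The real part of a <v,w> + a1 <v,z><z,w> for the Hermitian product. The values a of f' and a1 of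
    f'' are free parameters, which keeps the linear algebra independent of f. *)
Definition hermitian_form (a a1 : R) z v w : R :=
  a * edot v w
  + a1 * (edot v z * edot w z + edot v (Jmul z) * edot w (Jmul z)).

Local Arguments zcoord : simpl never.
Local Arguments conjc : simpl never.

Lemma metricE f z v w : metric f z v w =
  hermitian_form (f^`()%classic (radius2 z)) (f^`(2)%classic (radius2 z)) z v w.
Proof.
rewrite /metric; set a := f^`() _; set a1 := f^`(2) _.
have -> : \sum_i \sum_j kahler_matrix f z i j * zcoord v i * conjc (zcoord w j)
   = real_complex _ a * hdot v w + real_complex _ a1 * (hdot v z * hdot z w).
  rewrite /hdot mulr_sumr mulr_suml [X in _ = _ + X]mulr_sumr -big_split.
  apply: eq_bigr => i _ /=.
  rewrite 2!mulr_sumr (bigD1 i) //= [in RHS](bigD1 i) //= !mxE eqxx mulr1 -/a -/a1.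
  rewrite addrA; congr (_ + _); first by ring.
  apply: eq_bigr => j ij; rewrite !mxE eq_sym (negbTE ij) mulr0 add0r -/a1.
  by ring.
rewrite !hdotE /hermitian_form (edot_Jmul z w) (edotC w z).
by rewrite /= !mul0r !subr0; ring.
Qed.

Section Form.
Variables (a a1 : R) (z : V).
Local Notation h := (hermitian_form a a1 z).

Lemma hformC v w : h v w = h w v.
Proof. by rewrite /hermitian_form (edotC v w); ring. Qed.

Lemma hformDl u v w : h (u + v) w = h u w + h v w.
Proof. by rewrite /hermitian_form !edotDl; ring. Qed.

Lemma hformZl c v w : h (c *: v) w = c * h v w.
Proof. by rewrite /hermitian_form !edotZl; ring. Qed.

Lemma hformDr u v w : h w (u + v) = h w u + h w v.
Proof. by rewrite !(hformC w) hformDl. Qed.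

Lemma hformZr c v w : h w (c *: v) = c * h w v.
Proof. by rewrite !(hformC w) hformZl. Qed.

Lemma hform_radial v : h v z = (a + radius2 z * a1) * edot v z.
Proof. by rewrite /hermitian_form edot_Jmul0 -/(radius2 z); ring. Qed.

Lemma hform_Jradial v : h v (Jmul z) = (a + radius2 z * a1) * edot v (Jmul z).
Proof.
by rewrite /hermitian_form edot_JmulJmul (edotC (Jmul z) z) edot_Jmul0 -/(radius2 z); ring.
Qed.

(* For a1 < 0 positivity follows from Bessel's inequality for the orthogonal
   pair z, Jz. *)
Lemma hform_gt0 v : z != 0 -> 0 < a -> 0 < a + radius2 z * a1 -> v != 0 ->
  0 < h v v.
Proof.
move=> z0 a0 b0 v0; have S0 : 0 < radius2 z by rewrite radius2_gt0.
have V0 : 0 < edot v v by rewrite -[edot v v]/(radius2 v) radius2_gt0.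
pose x := edot v z; pose y := edot v (Jmul z).
have bessel : x ^+ 2 + y ^+ 2 <= radius2 z * edot v v.
  (* This vector is |z|^2 times the part of v orthogonal to z and Jz; the factor avoids a
     division. *)
  have := radius2_ge0 (radius2 z *: v - x *: z - y *: Jmul z).
  rewrite /radius2 !(edotBl, edotBr, edotZl, edotZr) edot_JmulJmul.
  rewrite (edotC z v) (edotC (Jmul z) v) (edotC (Jmul z) z) edot_Jmul0.
  rewrite -/x -/y -/(radius2 z) => H.
  have {H} : 0 <= radius2 z * (radius2 z * edot v v - x ^+ 2 - y ^+ 2).
    by apply: le_trans H _; rewrite le_eqVlt; apply/orP; left; apply/eqP; ring.
  by rewrite pmulr_rge0 //; lra.
rewrite /hermitian_form -/x -/y -!expr2.
have [a10|a10] := leP 0 a1.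
  apply: ltr_pwDl; first exact: mulr_gt0.
  by rewrite mulr_ge0 // addr_ge0 ?sqr_ge0.
have := mulr_gt0 b0 V0.
have : a1 * (radius2 z * edot v v) <= a1 * (x ^+ 2 + y ^+ 2).
  by rewrite ler_nM2l.
by lra.
Qed.

End Form.

Definition form_matrix a a1 z : 'M[R]_(m + m) :=
  \matrix_(k, l) hermitian_form a a1 z (basis_vec k) (basis_vec l).

Lemma form_matrixE a a1 z v w :
  (v *m form_matrix a a1 z *m w^T) 0 0 = hermitian_form a a1 z v w.
Proof.
rewrite -(sum_scalar w (phi := hermitian_form a a1 z v)) => [|x y|c x];
  rewrite ?hformDr ?hformZr //.
rewrite mxE; apply: eq_bigr => l _; rewrite [w^T _ _]mxE mulrC; congr (_ * _).
rewrite mxE -(sum_scalar v (phi := hermitian_form a a1 z ^~ _)) => [|x y|c x];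
  rewrite ?hformDl ?hformZl //.
by apply: eq_bigr => k _; rewrite mxE.
Qed.

Lemma metric_matrixE f z : metric_matrix f z =
  form_matrix (f^`()%classic (radius2 z)) (f^`(2)%classic (radius2 z)) z.
Proof. by apply/matrixP => k l; rewrite !mxE metricE. Qed.

Lemma form_matrix_unit a a1 z : z != 0 -> 0 < a -> 0 < a + radius2 z * a1 ->
  form_matrix a a1 z \in unitmx.
Proof.
move=> z0 a0 b0; rewrite -row_free_unit -kermx_eq0; apply/rowV0P => v.
move=> /sub_kermxP vG; apply/eqP/negPn/negP => v0.
by have := hform_gt0 z0 a0 b0 v0; rewrite -form_matrixE vG mul0mx mxE ltxx.
Qed.

Lemma form_matrix_tr a a1 z : (form_matrix a a1 z)^T = form_matrix a a1 z.
Proof. by apply/matrixP => k l; rewrite !mxE hformC. Qed.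

End MetricAlgebra.

(** * Calculus of directional derivatives *)

Section DirectionalDerivatives.
Context {R : realType} {E : normedModType R}.

(** Restriction to a line reduces directional derivatives to one variable. The chain rule below thus
    asks only for a derivative of h in the direction v, not for differentiability of h. *)
Lemma is_derive_along (W : normedModType R) (h : E -> W) x v dh :
  is_derive x v h dh <-> is_derive (0 : R) (1 : R) (fun s : R => h (s *: v + x)) dh.
Proof.
have dE : 'D_v h x = 'D_1 (fun s : R => h (s *: v + x)) 0.
  rewrite /derive; set g1 := fun s => _; set g2 := fun s => _.
  suff -> : g1 = g2 by [].
  by rewrite funeqE /g1 /g2 => s /=; rewrite addr0 scale0r add0r [_%:A]mulr1.
by split=> -[dx <-]; apply: DeriveDef; rewrite ?dE //;
  [exact: (derivable1P h x v).1 | exact: (derivable1P h x v).2].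
Qed.

Lemma is_derive_chain (phi : R -> R) (h : E -> R) x v dphi dh :
  is_derive x v h dh -> is_derive (h x) 1 phi dphi ->
  is_derive x v (fun y => phi (h y)) (dphi * dh).
Proof.
move=> /is_derive_along dhx dphix; apply/is_derive_along.
have dphix' : is_derive (h ((0 : R) *: v + x)) (1 : R) phi dphi.
  by rewrite scale0r add0r.
by have := @is_derive1_comp _ phi _ _ _ _ dphix' dhx.
Qed.

Lemma is_derive_mul (h k : E -> R) x v dh dk :
  is_derive x v h dh -> is_derive x v k dk ->
  is_derive x v (fun y => h y * k y) (dh * k x + h x * dk).
Proof.
move=> hx kx; apply: is_derive_eq (is_deriveM hx kx) _.
by rewrite /GRing.scale /=; ring.
Qed.

Lemma is_derive_add (h k : E -> R) x v dh dk :
  is_derive x v h dh -> is_derive x v k dk ->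
  is_derive x v (fun y => h y + k y) (dh + dk).
Proof. exact: is_deriveD. Qed.

Lemma is_derive_const (c : R) x v : is_derive x v (fun _ : E => c) 0.
Proof. exact: is_derive_cst. Qed.

Lemma is_derive_sumr (n : nat) (h : 'I_n -> E -> R) dh x v :
  (forall i, is_derive x v (h i) (dh i)) ->
  is_derive x v (fun y => \sum_i h i y) (\sum_i dh i).
Proof.
move=> hx; rewrite (_ : (fun _ => _) = \sum_i h i); first exact: is_derive_sum.
by apply/funext => y; rewrite fct_sumE.
Qed.

Context {m : nat}.
Local Notation V := 'rV[R]_(m + m).

Lemma is_derive_rV (n : nat) (h : E -> 'rV[R]_n) x v dh :
  is_derive x v h dh <-> forall k, is_derive x v (fun y => h y 0 k) (dh 0 k).
Proof.
split=> [[hx <-] k|hx].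
  apply: DeriveDef; first by have /derivable_mxP := hx; apply.
  by rewrite derive_mx // mxE.
have hx' : derivable h x v.
  by apply/derivable_mxP => i k; rewrite ord1; have [] := hx k.
apply: DeriveDef => //; rewrite derive_mx //; apply/rowP => k.
by rewrite mxE; have [] := hx k.
Qed.

Lemma is_derive_edot (h k : E -> V) x v dh dk :
  is_derive x v h dh -> is_derive x v k dk ->
  is_derive x v (fun y => edot (h y) (k y)) (edot dh (k x) + edot (h x) dk).
Proof.
move=> /is_derive_rV hx /is_derive_rV kx.
by rewrite /edot -big_split; apply: is_derive_sumr => i; apply: is_derive_mul.
Qed.

Lemma is_derive_radius2 (h : E -> V) x v dh :
  is_derive x v h dh ->
  is_derive x v (fun y => radius2 (h y)) (2 * edot dh (h x)).
Proof.
by move=> hx; apply: is_derive_eq (is_derive_edot hx hx) _;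
  rewrite (edotC (h x)); ring.
Qed.

End DirectionalDerivatives.

(** * The Levi-Civita connection paired with the metric *)

Section Christoffel.
Context {R : realType} {m : nat}.
Local Notation V := 'rV[R]_(m + m).
Implicit Types (u v w x z : V) (a : R) (f : R -> R).

Lemma is_derive_ident (E : normedModType R) (x v : E) :
  is_derive x v (fun y => y) v.
Proof. exact: is_derive_id. Qed.

Lemma is_derive_Jmul z c : is_derive z c (@Jmul R m) (Jmul c).
Proof.
apply/is_derive_rV => k.
have idk := (is_derive_rV (fun y : V => y) z c c).1 (is_derive_ident z c).
case: (split_ordP k) => j ->.
  under eq_fun do rewrite Jmul_l; rewrite Jmul_l.
  exact: is_deriveN (idk _).
by under eq_fun do rewrite Jmul_r; rewrite Jmul_r.
Qed.

(* The derivative at z in the direction c of [metric f _ v w], where a, a1, a2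
   are the values of f', f'', f''' at [radius2 z]. *)
Definition dform a1 a2 z c v w : R :=
  2 * edot c z * hermitian_form a1 a2 z v w
  + a1 * (edot v c * edot w z + edot v z * edot w c
          + edot v (Jmul c) * edot w (Jmul z)
          + edot v (Jmul z) * edot w (Jmul c)).

Lemma is_derive_metric f z c v w a1 a2 :
  is_derive (radius2 z) 1 f^`() a1 -> is_derive (radius2 z) 1 f^`(2) a2 ->
  is_derive z c (fun y => metric f y v w) (dform a1 a2 z c v w).
Proof.
move=> d1 d2; under eq_fun do rewrite metricE /hermitian_form.
have f2 : f^`(2)%classic (radius2 z) = a1.
  by rewrite derive1nS derive1n1 derive1E; case: d1.
have idz := is_derive_ident z c.
have dr := is_derive_radius2 idz.
have dl u : is_derive z c (fun y : V => edot u y) (edot u c).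
  by have := is_derive_edot (is_derive_cst u z c) idz; rewrite edot0l add0r.
have dJ u : is_derive z c (fun y : V => edot u (Jmul y)) (edot u (Jmul c)).
  by have := is_derive_edot (is_derive_cst u z c) (is_derive_Jmul z c);
    rewrite edot0l add0r.
have D1 := is_derive_mul (is_derive_chain dr d1) (is_derive_const (edot v w) z c).
have D2 := is_derive_mul (is_derive_chain dr d2)
  (is_derive_add (is_derive_mul (dl v) (dl w)) (is_derive_mul (dJ v) (dJ w))).
apply: is_derive_eq (is_derive_add D1 D2) _.
by rewrite f2 /dform /hermitian_form; ring.
Qed.

Lemma dmetricE f z a1 a2 k i j :
  is_derive (radius2 z) 1 f^`() a1 -> is_derive (radius2 z) 1 f^`(2) a2 ->
  dmetric f z k i j = dform a1 a2 z (basis_vec k) (basis_vec i) (basis_vec j).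
Proof.
move=> d1 d2; rewrite /dmetric; under eq_fun do rewrite mxE.
by case: (is_derive_metric (basis_vec k) (basis_vec i) (basis_vec j) d1 d2).
Qed.

(** The Koszul formula for constant vector fields, whose brackets vanish. *)
Lemma metric_christoffel f z v w u a1 a2 :
  is_derive (radius2 z) 1 f^`() a1 -> is_derive (radius2 z) 1 f^`(2) a2 ->
  metric_matrix f z \in unitmx ->
  metric f z (christoffel_form f z v w) u =
  2^-1 * (dform a1 a2 z v w u + dform a1 a2 z w v u - dform a1 a2 z u v w).
Proof.
move=> d1 d2 Gunit; set G := metric_matrix f z in Gunit.
(* The Christoffel form is the covector [d] times the inverse metric matrix, so pairing it with the
   metric cancels the inverse. *)
pose D i j l := dform a1 a2 z (basis_vec i) (basis_vec j) (basis_vec l)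
  + dform a1 a2 z (basis_vec j) (basis_vec i) (basis_vec l)
  - dform a1 a2 z (basis_vec l) (basis_vec i) (basis_vec j).
pose d : V := \row_l (2^-1 * \sum_i v 0 i * \sum_j w 0 j * D i j l).
have -> : christoffel_form f z v w = d *m (invmx G)^T.
  apply/rowP => k; rewrite !mxE.
  under [RHS]eq_bigr => l _.
    rewrite !mxE mulr_sumr mulr_suml; over.
  rewrite [RHS]exchange_big /=; apply: eq_bigr => i _.
  under [RHS]eq_bigr => l _.
    rewrite !mulr_sumr mulr_suml; over.
  rewrite [RHS]exchange_big /=; apply: eq_bigr => j _.
  rewrite /christoffel mulr_sumr mulr_suml mulr_suml; apply: eq_bigr => l _.
  by rewrite !(dmetricE _ _ _ d1 d2) -/G /D; ring.
rewrite metricE -form_matrixE -metric_matrixE -/G.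
have GT : G^T = G by rewrite /G metric_matrixE form_matrix_tr.
rewrite -(mulmxA d) -{2}GT -trmx_mul mulmxV // trmx1 mulmx1 mxE.
transitivity (\sum_l u 0 l * d 0 l).
  by apply: eq_bigr => l _; rewrite [u^T _ _]mxE mulrC.
pose D' v w u := dform a1 a2 z v w u + dform a1 a2 z w v u - dform a1 a2 z u v w.
pose lins := (edotDl, edotZl, edotDr, edotZr, JmulD, JmulZ).
rewrite -[RHS]/(2^-1 * D' v w u).
(* [D'] is linear in each of u, v and w, so the three coordinate sums are removed one at a time. *)
rewrite -(sum_scalar u (phi := D' v w)) => [|x y|c x]; last 2 first.
- by rewrite /D' /dform /hermitian_form !lins; ring.
- by rewrite /D' /dform /hermitian_form !lins; ring.
rewrite mulr_sumr; apply: eq_bigr => l _; rewrite mxE mulrCA; congr (_ * (_ * _)).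
rewrite -(sum_scalar v (phi := fun v => D' v w _)) => [|x y|c x]; last 2 first.
- by rewrite /D' /dform /hermitian_form !lins; ring.
- by rewrite /D' /dform /hermitian_form !lins; ring.
apply: eq_bigr => i _; congr (_ * _).
rewrite -(sum_scalar w (phi := fun w => D' _ w _)) => [|x y|c x] //.
- by rewrite /D' /dform /hermitian_form !lins; ring.
- by rewrite /D' /dform /hermitian_form !lins; ring.
Qed.

(** The only contraction of the connection that enters the curvature: v and w are tangent to a
    centred sphere and the normal is radial. The coefficient is minus the derivative of b = a + S a1
    with respect to S. *)
Lemma metric_christoffel_radial f z v w a1 a2 :
  is_derive (radius2 z) 1 f^`() a1 -> is_derive (radius2 z) 1 f^`(2) a2 ->
  metric_matrix f z \in unitmx -> edot v z = 0 -> edot w z = 0 ->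
  metric f z (christoffel_form f z v w) z =
  - (2 * a1 + radius2 z * a2) * edot v (Jmul z) * edot w (Jmul z).
Proof.
move=> d1 d2 Gunit vz wz; rewrite (metric_christoffel _ _ _ d1 d2 Gunit).
rewrite /dform /hermitian_form vz wz !edot_Jmul0 (edotC z v) vz (edotC z w) wz.
rewrite (edotC w v) (edot_Jmul z v) (edot_Jmul z w) -/(radius2 z).
by rewrite [edot w (Jmul v)]edot_Jmul; field.
Qed.

End Christoffel.

(** * Second fundamental form at a critical point of the radius *)

Lemma is_derive_derive1n (R : realType) (f : R -> R) k x :
  derivable f^`(k) x 1 -> is_derive x 1 f^`(k) (f^`(k.+1)%classic x).
Proof. by move=> d; apply: DeriveDef; [exact: d|rewrite derive1nS -derive1E]. Qed.

Lemma is_derive_derive11 (R : realType) (f : R -> R) x :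
  derivable f^`() x 1 -> is_derive x 1 f^`() (f^`(2)%classic x).
Proof. by move=> d; apply: DeriveDef; [exact: d|rewrite -derive1E]. Qed.

(** [parseval] for the tangent frame completed by the unit normal z / sqrt(S b). The normal
    contribution is written out as b/S <u,z><w,z>, so no square root survives in the statement. *)
Lemma metric_parseval (R : realType) (m : nat) (a a1 : R) (z u w : 'rV[R]_(m + m))
    (X : 'I_(m + m).-1 -> 'rV[R]_(m + m)) :
  let b := a + radius2 z * a1 in
  (0 < m)%N -> z != 0 -> 0 < b ->
  (forall i j, hermitian_form a a1 z (X i) (X j) = (i == j)%:R) ->
  (forall i, edot (X i) z = 0) ->
  \sum_i hermitian_form a a1 z u (X i) * hermitian_form a a1 z (X i) w
    + b * (radius2 z)^-1 * edot u z * edot w z = hermitian_form a a1 z u w.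
Proof.
case: m z u w X => [//|m] z u w X b _ z0 b0 XX Xz.
have S0 : 0 < radius2 z by rewrite radius2_gt0.
pose s := Num.sqrt (radius2 z * b).
have s2 : s ^+ 2 = radius2 z * b by rewrite sqr_sqrtr // ltW // mulr_gt0.
have s0 : s != 0 by rewrite -sqrf_eq0 s2 mulf_neq0 // gt_eqF.
rewrite -(@parseval R (m + m.+1) (form_matrix a a1 z) (hermitian_form a a1 z)
  X (s^-1 *: z) u w) //; last 4 first.
- by move=> x y; exact: esym (@form_matrixE R m.+1 a a1 z x y).
- by move=> i; rewrite hformZr hform_radial Xz !mulr0.
- by move=> i; rewrite hformZl hformC hform_radial Xz !mulr0.
- rewrite hformZl hformZr hform_radial -/(radius2 z) -/b.
  by rewrite (mulrC b) -s2; field.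
congr (_ + _).
rewrite hformZl hformZr hform_radial (hformC _ _ _ z) hform_radial -/b.
transitivity ((s ^+ 2)^-1 * b ^+ 2 * edot u z * edot w z); last by field.
rewrite s2; field.
by rewrite !gt_eqF.
Qed.

(** * Trace and norm of the sphere form in an orthonormal frame *)

Section Frame.
Context {R : realType} {m : nat}.
Local Notation V := 'rV[R]_(m + m).
Variables (a a1 b1 : R) (z : V) (X : 'I_(m + m).-1 -> V).
Local Notation S := (radius2 z).
Local Notation b := (a + S * a1).
Local Notation h := (hermitian_form a a1 z).
Hypothesis m_gt0 : (0 < m)%N.
Hypothesis z_neq0 : z != 0.
Hypothesis a_gt0 : 0 < a.
Hypothesis b_gt0 : 0 < b.
Hypothesis XX : forall i j, h (X i) (X j) = (i == j)%:R.
Hypothesis Xz : forall i, edot (X i) z = 0.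

Let S_gt0 : 0 < S. Proof. by rewrite radius2_gt0. Qed.
Let S_neq0 : S != 0. Proof. by rewrite gt_eqF. Qed.
Let a_neq0 : a != 0. Proof. by rewrite gt_eqF. Qed.
Let b_neq0 : b != 0. Proof. by rewrite gt_eqF. Qed.
Let pars v w := metric_parseval v w m_gt0 z_neq0 b_gt0 XX Xz.

Lemma frame_normal_radial n : h n n = 1 -> (forall i, h (X i) n = 0) ->
  exists2 s, n = s *: z & s ^+ 2 * S * b = 1.
Proof.
move=> nn nX.
(* The difference of both sides is orthogonal to every X i and to z. By Parseval its norm is 0, so
   it vanishes by positivity. *)
have nE : n = (edot n z / S) *: z.
  apply/eqP; rewrite -subr_eq0; apply/negPn/negP => y0.
  have := hform_gt0 z_neq0 a_gt0 b_gt0 y0.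
  rewrite -pars big1 => [|i _]; last first.
    rewrite -scaleNr hformDl hformZl (hformC _ _ _ n) nX (hformC _ _ _ z).
    by rewrite hform_radial Xz !mulr0 addr0 mul0r.
  by rewrite edotBl edotZl -/(radius2 z) divfK // subrr !mulr0 addr0 ltxx.
exists (edot n z / S) => //.
move: nn; set s := edot n z / S in nE *; rewrite nE.
by rewrite hformZl hformZr hform_radial -/(radius2 z) => <-; ring.
Qed.

(** Parseval for Jz: since h(Jz, X i) = b <Jz, X i> and h(Jz, Jz) = b S, the sum multiplied by b^2
    equals b S. *)
Lemma sum_sqr_hopf : \sum_i edot (X i) (Jmul z) ^+ 2 = S / b.
Proof.
have := pars (Jmul z) (Jmul z).
rewrite hform_Jradial edot_JmulJmul -/(radius2 z) (edotC (Jmul z)) edot_Jmul0.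
rewrite !mulr0 addr0.
under eq_bigr => i _ do
  rewrite (hformC _ _ _ (Jmul z)) hform_Jradial mulrACA -expr2 -expr2.
rewrite -mulr_sumr => hS.
have -> : S / b = (b ^+ 2)^-1 * (b * S) by field.
by rewrite -hS mulKf // sqrf_eq0.
Qed.

(** The orthonormality relation solved for the Euclidean product, so that trace and norm below
    reduce to [sum_sqr_hopf]. *)
Let edotXX i j : edot (X i) (X j) =
  ((i == j)%:R - a1 * (edot (X i) (Jmul z) * edot (X j) (Jmul z))) / a.
Proof. by rewrite -XX /hermitian_form !Xz mul0r add0r; field. Qed.

Let card_frame : \sum_(i < (m + m).-1) (1 : R) = (m + m).-2%:R + 1.
Proof.
rewrite sumr_const card_ord -mulrSr; congr (_ *+ _).
by case: (m) m_gt0 => // k _; rewrite addnS.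
Qed.

(* Up to the factor -1/sqrt(S b), the form whose trace and norm are computed
   is the second fundamental form of the sphere through z. *)
Lemma trace_sphere_form :
  \sum_i (b * edot (X i) (X i)
          + b1 * edot (X i) (Jmul z) * edot (X i) (Jmul z)) =
  (m + m).-2%:R * (b / a) + (1 + S * b1 / b).
Proof.
under eq_bigr => i _ do rewrite edotXX eqxx -mulrA -expr2.
rewrite big_split /= -!mulr_sumr.
rewrite sum_sqr_hopf -mulr_suml sumrB -mulr_sumr sum_sqr_hopf card_frame.
by field; rewrite b_neq0 a_neq0.
Qed.

Lemma sqr_norm_sphere_form :
  \sum_i \sum_j (b * edot (X i) (X j)
    + b1 * edot (X i) (Jmul z) * edot (X j) (Jmul z)) ^+ 2 =
  (m + m).-2%:R * (b / a) ^+ 2 + (1 + S * b1 / b) ^+ 2.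
Proof.
(* In the frame, the form is b/a times the identity plus the rank-one matrix c x_i x_j. *)
pose c := b1 - b * a1 / a; pose x i := edot (X i) (Jmul z).
have delta i (y : 'I_(m + m).-1 -> R) : \sum_j y j * (i == j)%:R = y i.
  rewrite (bigD1 i) //= eqxx mulr1 big1 ?addr0 // => j ji.
  by rewrite eq_sym (negbTE ji) mulr0.
have formE i j :
    (b * edot (X i) (X j) + b1 * x i * x j) ^+ 2 =
    (b / a) ^+ 2 * (i == j)%:R + (2 * (b / a) * c * x i) * (x j * (i == j)%:R)
     + c ^+ 2 * x i ^+ 2 * x j ^+ 2.
  by rewrite edotXX -/(x i) -/(x j) /c; case: (i == j) => /=; field.
have inner i : \sum_j (b * edot (X i) (X j) + b1 * x i * x j) ^+ 2
    = (b / a) ^+ 2 * 1 + 2 * (b / a) * c * x i ^+ 2 + c ^+ 2 * (S / b) * x i ^+ 2.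
  under eq_bigr => j _ do rewrite formE.
  rewrite !big_split /= -!mulr_sumr sum_sqr_hopf !delta.
  have := delta i (fun=> 1); rewrite -[X in X = _ -> _]mulr_sumr mul1r => ->.
  by ring.
under eq_bigr => i _ do rewrite inner.
rewrite !big_split /= -!mulr_sumr sum_sqr_hopf card_frame.
by rewrite /c; field; rewrite b_neq0 a_neq0.
Qed.

End Frame.

Section Hypersurface.
Context {R : realType} {m : nat}.
Local Notation V := 'rV[R]_(m + m).
Variables (f : R -> R) (R0 : R) (F : V -> R -> V) (t : R) (p : V).
Hypothesis m_gt0 : (0 < m)%N.
Hypothesis R0_gt0 : 0 < R0.
Hypothesis p_sphere : hypersphere R0 p.
Local Notation q := (F p t).
Local Notation G := (ray_ext R0 F t).
Local Notation dF := (differential R0 F t p).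
Hypothesis q_neq0 : q != 0.
Local Notation S := (radius2 q).
Local Notation a := (f^`()%classic S).
Local Notation a1 := (f^`(2)%classic S).
Local Notation a2 := (f^`(3)%classic S).
Local Notation b := (a + S * a1).
Local Notation b1 := (2 * a1 + S * a2).
Hypothesis a_gt0 : 0 < a.
Hypothesis b_gt0 : 0 < b.
Hypothesis da : derivable f^`() S 1.
Hypothesis da1 : derivable f^`(2) S 1.
Hypothesis G_derivable : forall w, \forall y \near p, derivable G y w.
Hypothesis DG_derivable : forall v w, derivable ('D_w G) p v.
Local Notation u := (fun y => radius2 (G y)).

Let S_gt0 : 0 < S. Proof. by rewrite radius2_gt0. Qed.
Let S_neq0 : S != 0. Proof. by rewrite gt_eqF. Qed.
Let a_neq0 : a != 0. Proof. by rewrite gt_eqF. Qed.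
Let b_neq0 : b != 0. Proof. by rewrite gt_eqF. Qed.

Lemma ray_ext_sphere : G p = q.
Proof.
by rewrite /ray_ext (p_sphere : enorm p = R0) divff ?scale1r // gt_eqF.
Qed.

Lemma derive_radius2_ray_ext w : \forall y \near p,
  is_derive y w u (2 * edot ('D_w G y) (G y)).
Proof.
near=> y; apply: is_derive_radius2; apply: derivableP.
by near: y; exact: G_derivable.
Unshelve. all: by end_near. Qed.

(** Two applications of the product rule to |G|^2. Read backwards, it expresses the radial component
    of the second derivative of F through the Hessian of |F|^2. *)
Lemma derive2_radius2_ray_ext v w : is_derive p v ('D_w u)
  (2 * (edot ('D_v ('D_w G) p) q + edot (dF v) (dF w))).
Proof.
have d1 : is_derive p v ('D_w G) ('D_v ('D_w G) p) by exact: derivableP.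
have d2 : is_derive p v G (dF v).
  by apply: derivableP; exact: nbhs_singleton (G_derivable v).
apply: (near_eq_is_derive (f := fun y => 2 * edot ('D_w G y) (G y))).
  near=> y; apply/esym.
  have [//] : is_derive y w u (2 * edot ('D_w G y) (G y)).
  by near: y; exact: derive_radius2_ray_ext.
apply: is_derive_eq (is_derive_mul (is_derive_const 2 p v) (is_derive_edot d1 d2)) _.
rewrite mul0r add0r ray_ext_sphere.
have comm (A X Y z : V) : 2 * (edot A z + edot Y X) = 2 * (edot A z + edot X Y).
  by rewrite (edotC Y).
exact: comm.
Unshelve. all: by end_near. Qed.

(** The Hessian of u replaces the second derivative of F; the remaining two terms are the second
    fundamental form of the centred sphere through q. *)
Lemma second_fundamental_form_radial s v w :
  edot (dF v) q = 0 -> edot (dF w) q = 0 ->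
  second_fundamental_form f R0 F t p (s *: q) v w =
  s * (b / 2 * 'D_v ('D_w u) p - b * edot (dF v) (dF w)
       - b1 * edot (dF v) (Jmul q) * edot (dF w) (Jmul q)).
Proof.
move=> vq wq; rewrite /second_fundamental_form metricE hformZr hformDl -!metricE.
have Gu : metric_matrix f q \in unitmx.
  by rewrite metric_matrixE; exact: form_matrix_unit.
have d1 : is_derive S 1 f^`() a1.
  exact: is_derive_derive11.
have d2 : is_derive S 1 f^`(2) a2.
  exact: is_derive_derive1n.
rewrite (metric_christoffel_radial d1 d2 Gu vq wq) metricE hform_radial.
have [_ ->] := derive2_radius2_ray_ext v w.
have alg (A B x y b c : R) :
  s * (b * A + - c * x * y) = s * (b / 2 * (2 * (A + B)) - b * B - c * x * y).
  by field.
exact: alg.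
Qed.

Section AdaptedFrame.
Variable e : 'I_(m + m).-1 -> V.
Hypothesis e_orthonormal : orthonormal_frame f R0 F t p e.
Hypothesis dF_tangent : forall v, tangent p v -> edot (dF v) q = 0.
Local Notation kappa := ((m + m).-2%:R * (b / a) + (1 + S * b1 / b)).

Let XX i j : hermitian_form a a1 q (dF (e i)) (dF (e j)) = (i == j)%:R.
Proof. by rewrite -metricE; apply: (e_orthonormal.2 i j). Qed.

Let Xq i : edot (dF (e i)) q = 0.
Proof. by apply: dF_tangent; apply: (e_orthonormal.1 i). Qed.

Lemma unit_normal_radial n : unit_normal f R0 F t p n ->
  exists2 s, n = s *: q & s ^+ 2 * S * b = 1.
Proof.
move=> [nn nX]; apply: (frame_normal_radial m_gt0 q_neq0 a_gt0 b_gt0 XX Xq).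
  by rewrite -metricE.
by move=> i; rewrite -metricE; apply: nX; apply: (e_orthonormal.1 i).
Qed.

Lemma trace_second_fundamental_form s :
  \sum_i second_fundamental_form f R0 F t p (s *: q) (e i) (e i) =
  s * (b / 2 * \sum_i 'D_(e i) ('D_(e i) u) p - kappa).
Proof.
rewrite -(trace_sphere_form b1 m_gt0 q_neq0 a_gt0 b_gt0 XX Xq).
rewrite [b / 2 * _]mulr_sumr -sumrB mulr_sumr; apply: eq_bigr => i _.
rewrite second_fundamental_form_radial //.
have alg (A B C : R) : s * (A - B - C) = s * (A - (B + C)) by ring.
exact: alg.
Qed.

Lemma sqr_norm_second_fundamental_form s :
  s ^+ 2 * S * b = 1 ->
  (forall i j, 'D_(e i) ('D_(e j) u) p = 0) ->
  \sum_i \sum_j second_fundamental_form f R0 F t p (s *: q) (e i) (e j) ^+ 2 =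
  ((m + m).-2%:R * (b / a) ^+ 2 + (1 + S * b1 / b) ^+ 2) / b / S.
Proof.
move=> s2 DDu.
rewrite -(sqr_norm_sphere_form b1 m_gt0 q_neq0 a_gt0 b_gt0 XX Xq).
have sE : b^-1 / S = s ^+ 2.
  apply: (mulIf S_neq0); apply: (mulIf b_neq0).
  by rewrite s2 divfK // mulVf.
rewrite -mulrA sE mulr_suml; apply: eq_bigr => i _.
rewrite mulr_suml; apply: eq_bigr => j _.
rewrite second_fundamental_form_radial // DDu mulr0 sub0r.
have alg (A B : R) : (s * (- A - B)) ^+ 2 = (A + B) ^+ 2 * s ^+ 2 by ring.
exact: alg.
Qed.

End AdaptedFrame.

(** Along a flow the left-hand side of the last equation is the time derivative of |F|^2. The scale
    s enters it only through s^2 S = 1/b, so the choice of normal does not matter. *)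
Lemma mean_curvature_radial_speed n H :
  unit_normal f R0 F t p n -> mean_curvature f R0 F t p n H ->
  (forall v, tangent p v -> edot (dF v) q = 0) ->
  exists s (e : 'I_(m + m).-1 -> V), [/\ n = s *: q,
    forall i, tangent p (e i) &
    2 * edot (H *: n) q = (\sum_i 'D_(e i) ('D_(e i) u) p
      - 2 * ((m + m).-2%:R * (b / a) + (1 + S * b1 / b)) / b) / (m + m).-1%:R].
Proof.
move=> nn [k [[e [eo ek]] ->]] dFt.
have [s nE s2] := unit_normal_radial eo dFt nn.
exists s, e; split=> //; first exact: eo.1.
have -> : \sum_i k i = \sum_i second_fundamental_form f R0 F t p n (e i) (e i).
  by apply: eq_bigr => i _; rewrite ek eqxx.
rewrite nE trace_second_fundamental_form // !edotZl -/(radius2 q).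
have alg (c r D K N : R) : c != 0 -> s ^+ 2 * r * c = 1 ->
    2 * (s * (c / 2 * D - K) * N * (s * r)) = (D - 2 * K / c) * N.
  move=> c0 src; have sr : s ^+ 2 * r = c^-1.
    by apply: (mulIf c0); rewrite src mulVf.
  transitivity (2 * (s ^+ 2 * r) * (c / 2 * D - K) * N); first by ring.
  by rewrite sr; field.
exact: alg.
Qed.

End Hypersurface.

(** * Power series and the radial ODE *)

Section PowerSeries.
Context {R : realType}.
Implicit Types (a : R^nat) (r x : R) (g : R -> R).

Lemma is_cvg_series_succ (w : R^nat) :
  cvgn (series w) -> cvgn (series (fun n => w n.+1)).
Proof.
rewrite -(@is_cvg_series_restrict 1) => /cvg_ex[l wl]; apply/cvg_ex; exists l.
move: wl; rewrite -cvg_shiftS => wl.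
suff -> : series (fun n => w n.+1) = [sequence \sum_(1 <= k < n.+1) w k]_n by [].
by apply/funext => n /=; rewrite /series /= big_add1.
Qed.

(* (n + 1) q^n <= 1 + q + ... + q^n <= 1 / (1 - q) absorbs the factor n + 1 of
   the differentiated series into a slightly larger radius. *)
Lemma is_cvg_pseries_diffs a r :
  (forall x, `|x| < r -> cvgn (pseries a x)) ->
  forall x, `|x| < r -> cvgn (pseries (pseries_diffs a) x).
Proof.
move=> acvg x xr.
have x0 := normr_ge0 x; have K0 : 0 < (`|x| + r) / 2 by lra.
set K := (`|x| + r) / 2 in K0.
have xK : `|x| < K by rewrite /K; lra.
(* Absolute convergence at K comes from convergence at the further midpoint (K + r) / 2. *)
have Kcvg : cvgn (pseries (fun n => `|a n|) K).
  apply: (@is_cvg_pseries_inside_norm _ a ((K + r) / 2)).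
    by apply: acvg; rewrite gtr0_norm; rewrite /K; lra.
  by rewrite !gtr0_norm; rewrite /K; lra.
pose q := `|x| / K.
have q0 : 0 <= q by rewrite divr_ge0 // ltW.
have q1 : q < 1 by rewrite ltr_pdivrMr // mul1r.
have qbound n : n.+1%:R * q ^+ n <= (1 - q)^-1.
  rewrite -[leRHS]mul1r ler_pdivlMr ?subr_gt0 //.
  have : \sum_(i < n.+1) q ^+ n <= \sum_(i < n.+1) q ^+ i.
    apply: ler_sum => i _; apply: ler_wiXn2l => //; first exact: ltW.
    by rewrite -ltnS ltn_ord.
  rewrite sumr_const card_ord -[q ^+ n *+ _]mulr_natl => le_sum.
  apply: (@le_trans _ _ ((\sum_(i < n.+1) q ^+ i) * (1 - q))).
    by rewrite ler_pM2r ?subr_gt0.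
  by rewrite -(opprB q 1) mulrN mulrC -subrX1 opprB gerBl exprn_ge0.
apply: normed_cvg.
apply: (@series_le_cvg _ _
  ((K * (1 - q))^-1 *: (fun n => `|a n.+1| * K ^+ n.+1))) => [n|n|n|] /=.
- by rewrite normr_ge0.
- apply: mulr_ge0; first by rewrite invr_ge0 mulr_ge0 ?subr_ge0 // ltW.
  by apply: mulr_ge0 => //; apply: exprn_ge0; exact: ltW.
- have -> : `|pseries_diffs a n * x ^+ n| =
      n.+1%:R * q ^+ n * (`|a n.+1| * K ^+ n).
    rewrite /pseries_diffs !normrM normr_nat normrX /q exprMn exprVn.
    by field; rewrite expf_neq0 // gt_eqF.
  have -> : ((K * (1 - q))^-1 *: (fun k => `|a k.+1| * K ^+ k.+1)) n =
      (1 - q)^-1 * (`|a n.+1| * K ^+ n).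
    transitivity ((K * (1 - q))^-1 * (`|a n.+1| * (K * K ^+ n))).
      by rewrite -exprS.
    by field; rewrite subr_eq0 !gt_eqF.
  by rewrite ler_wpM2r // mulr_ge0 // exprn_ge0 // ltW.
- by apply: is_cvg_seriesZ; exact: is_cvg_series_succ Kcvg.
Qed.

Lemma is_derive_analytic g a r x0 :
  (forall x, `|x - x0| < r -> pseries a (x - x0) @ \oo --> g x) ->
  forall x, `|x - x0| < r ->
    is_derive x 1 g (limn (pseries (pseries_diffs a) (x - x0))).
Proof.
move=> ga x xr; have x0' := normr_ge0 (x - x0).
have acvg y : `|y| < r -> cvgn (pseries a y).
  by move=> yr; apply/cvg_ex; exists (g (y + x0)); rewrite -{1}(addrK x0 y);
    apply: ga; rewrite addrK.
have dcvg := is_cvg_pseries_diffs acvg.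
have ddcvg := is_cvg_pseries_diffs dcvg.
(* Termwise differentiation asks for convergence of the series and of its first two derived series
   at one point K beyond |x - x0|. *)
pose K := (`|x - x0| + r) / 2.
have K0 : 0 < K by rewrite /K; lra.
have Kr : `|K| < r by rewrite gtr0_norm // /K; lra.
have xK : `|x - x0| < `|K| by rewrite [ltRHS]gtr0_norm // /K; lra.
have D := pseries_snd_diffs (acvg _ Kr) (dcvg _ Kr) (ddcvg _ Kr) xK.
have shift : is_derive x (1 : R) (fun y : R => y - x0) 1.
  by apply: is_derive_eq (is_deriveB (is_derive_id x 1) (is_derive_cst x0 x 1)) _;
    rewrite subr0.
have := @is_derive1_comp _ (fun y => limn (pseries a y)) (fun y => y - x0) x _ _
  D shift.
rewrite mulr1.
apply: near_eq_is_derive; near=> y; rewrite /=.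
apply/cvg_lim => //; apply: ga; near: y.
have : `]x0 - r, x0 + r[ x by rewrite /= in_itv /= -ltr_distlC distrC.
move=> /near_in_itvoo; apply: filterS => y.
by rewrite in_itv /= -ltr_distlC distrC.
Unshelve. all: by end_near. Qed.

Lemma real_analytic_derive g :
  real_analytic_nonneg g -> real_analytic_nonneg g^`()%classic.
Proof.
move=> ga x0 /ga[a [r [r0 {}ga]]]; exists (pseries_diffs a), r; split => // x xr.
rewrite derive1E; have [_ ->] := is_derive_analytic ga xr.
apply: is_cvg_pseries_diffs xr => y yr.
by apply/cvg_ex; exists (g (y + x0)); rewrite -{1}(addrK x0 y);
  apply: ga; rewrite addrK.
Qed.

Lemma real_analytic_derive1n g n :
  real_analytic_nonneg g -> real_analytic_nonneg (derive1n n g).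
Proof.
by move=> ga; elim: n => [//|n IHn]; rewrite derive1nS; exact: real_analytic_derive.
Qed.

Lemma real_analytic_derivable g n x0 : real_analytic_nonneg g -> 0 <= x0 ->
  \forall x \near x0, derivable (derive1n n g) x 1.
Proof.
move=> /(real_analytic_derive1n n) ga /ga[a [r [r0 {}ga]]].
have : `]x0 - r, x0 + r[ x0 by rewrite /= in_itv /= -ltr_distlC subrr normr0.
move=> /near_in_itvoo; apply: filterS => y.
rewrite in_itv /= -ltr_distlC distrC => yr.
by have [] := is_derive_analytic ga yr.
Qed.

End PowerSeries.

(** * The scalar equation S' = -phi(S) *)

Section ScalarFlow.
Context {R : realType}.

Lemma is_derive_continuous (h : R -> R) (x dh : R) :
  is_derive x (1 : R) h dh -> {for x, continuous h}.
Proof. by case=> /derivable1_diffP/differentiable_continuous. Qed.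

Lemma continuous_near_gt (T : topologicalType) (h : T -> R) x z :
  {for x, continuous h} -> z < h x -> \forall y \near x, z < h y.
Proof. by move=> hc hz; exact: (@cvgr_gt R T (nbhs x) (nbhs_filter x) h (h x) hc z hz). Qed.

Lemma continuous_near_lt (T : topologicalType) (h : T -> R) x z :
  {for x, continuous h} -> h x < z -> \forall y \near x, h y < z.
Proof. by move=> hc hz; exact: (@cvgr_lt R T (nbhs x) (nbhs_filter x) h (h x) hc z hz). Qed.

Lemma antiderivative (h : R -> R) (l r : R) : l < r ->
  (forall x, l <= x <= r -> {for x, continuous h}) ->
  exists H : R -> R, forall x : R, l < x < r -> is_derive x (1 : R) H (h x).
Proof.
move=> lr hc; exists (fun x => \int[lebesgue_measure]_(t in `[l, x]) h t)%R.
move=> x /andP[lx xr].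
have [||d dE] := @continuous_FTC1_closed R h l x r xr _ lx.
- apply: continuous_compact_integrable; first exact: segment_compact.
  apply: continuous_in_subspaceT => y; rewrite inE /= in_itv /=; exact: hc.
- by apply: hc; rewrite !ltW.
by apply: DeriveDef; [exact: d | rewrite -derive1E].
Qed.

(* S is the inverse of an antiderivative of 1/phi, run backwards in time. *)
Lemma scalar_flow (phi : R -> R) (c s0 : R) :
  (forall x, `|x| < c -> {for x, continuous phi}) ->
  (forall x, `|x| < c -> 0 < phi x) -> 0 < s0 < c ->
  exists T d (S : R -> R), [/\ 0 < T, 0 < d, S 0 = s0, S T = 0 &
    (forall t, - d < t < T + d -> `|S t| < c /\ is_derive t (1 : R) S (- phi (S t)))
    /\ forall t, - d < t < T -> 0 < S t].
Proof.
move=> phic phi0 /andP[s00 s0c].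
(* The margins s0 < e < c1 < c leave room for open intervals: H is differentiable on ]-c1, c1[ and
   is inverted on [-e, e]. *)
pose c1 := (s0 + c) / 2; pose e := (s0 + c1) / 2.
have [ec1 s0e c1c] : [/\ e < c1, s0 < e & c1 < c].
  by rewrite /e /c1; split; lra.
have inc x : - c1 <= x <= c1 -> `|x| < c.
  by move=> xc; apply: le_lt_trans c1c; rewrite ler_norml.
have [||H dH] := @antiderivative (fun x => (phi x)^-1) (- c1) c1.
- by lra.
- move=> x /inc xc; apply: continuousV; first by rewrite gt_eqF // phi0.
  exact: phic.
have sub x : - e <= x <= e -> - c1 < x < c1.
  by move=> /andP[? ?]; apply/andP; split; lra.
have Hc : {within `[- e, e], continuous H}.
  apply: continuous_in_subspaceT => x; rewrite inE /= in_itv /= => /sub xc.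
  exact: is_derive_continuous (dH x xc).
have Hincr x y : - e <= x -> x < y -> y <= e -> H x < H y.
  apply: gtr0_derive1_incr Hc x y => x; rewrite in_itv /= => /andP[x1 x2].
    by have [|] := dH x; first by apply: sub; rewrite !ltW.
  have xe : - e <= x <= e by rewrite !ltW.
  rewrite derive1E; have [|_ ->] := dH x; first exact: sub.
  by rewrite invr_gt0 phi0 //; apply: inc; have /andP[? ?] := sub x xe; rewrite !ltW.
have Hinj x y : - e <= x <= e -> - e <= y <= e -> H x = H y -> x = y.
  move=> /andP[x1 x2] /andP[y1 y2] Hxy; case: (ltgtP x y) => // xy.
    by have := Hincr _ _ x1 xy y2; rewrite Hxy ltxx.
  by have := Hincr _ _ y1 xy x2; rewrite Hxy ltxx.
(* The range condition sits under the existential so that [choice] yields a total function; outside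
   the range its value is arbitrary. *)
have Hsurj tau : exists x, H (- e) < tau < H e -> - e < x < e /\ H x = tau.
  have [tauI|] := boolP (H (- e) < tau < H e); last by exists 0.
  have [|||x] := @IVT R H (- e) e tau; rewrite ?Hc //.
  - by lra.
  - case/andP: tauI => t1 t2.
    by rewrite ge_min le_max (ltW t1) (ltW t2) orbT.
  rewrite in_itv /= => /andP[x1 x2] Hx; exists x => _; split => //.
  move: tauI; rewrite -Hx !lt_neqAle x1 x2 !andbT => /andP[/andP[n1 _] /andP[n2 _]].
  by apply/andP; split; [apply: contraNneq n1 => -> | apply: contraNneq n2 => ->].
have [sig sigP] := choice Hsurj.
have He : H (- e) < H 0 /\ H s0 < H e /\ H 0 < H s0.
  by split; [|split]; apply: Hincr; lra.
case: He => He1 [He2 He3].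
(* S(t) solves H (S t) = H s0 - t, so S reaches 0 at T = H s0 - H 0. The number d is how far t may
   overshoot [0, T] at either end before the right-hand side leaves the range of H on [-e, e]. *)
pose d := Num.min (H e - H s0) (H 0 - H (- e)).
have sigK x : - e < x < e -> sig (H x) = x.
  move=> /andP[x1 x2]; have [|/andP[y1 y2] Hy] := sigP (H x).
    by apply/andP; split; apply: Hincr => //; exact: ltW.
  by apply: Hinj Hy; rewrite !ltW.
have d1 : d <= H e - H s0 by rewrite ge_min lexx.
have d2 : d <= H 0 - H (- e) by rewrite ge_min lexx orbT.
have d0 : 0 < d by rewrite lt_min !subr_gt0 He1 He2.
have timeI t : - d < t < H s0 - H 0 + d -> H (- e) < H s0 - t < H e.
  by move=> /andP[? ?]; apply/andP; split; lra.
exists (H s0 - H 0), d, (fun t => sig (H s0 - t)); split.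
- by rewrite subr_gt0.
- exact: d0.
- by rewrite subr0 sigK //; apply/andP; split; lra.
- by rewrite subKr sigK //; apply/andP; split; lra.
split=> t tI.
  have [xI Hx] := sigP _ (timeI t tI); set x := sig _ in xI Hx *.
  have xI' : - e <= x <= e by case/andP: xI => ? ?; rewrite !ltW.
  have xc : `|x| < c by apply: inc; have /andP[? ?] := sub x xI'; rewrite !ltW.
  split => //.
  have dHx := dH x (sub x xI').
  have Dsig : is_derive (H x) 1 sig ((phi x)^-1^-1).
    apply: is_derive_inverse dHx _; last by rewrite invr_eq0 gt_eqF // phi0.
    - have : `]- e, e[ x by rewrite /= in_itv.
      move=> /near_in_itvoo; apply: filterS => y; rewrite in_itv /=; exact: sigK.
    - have : `]- e, e[ x by rewrite /= in_itv.
      move=> /near_in_itvoo; apply: filterS => y; rewrite in_itv /= => /andP[? ?].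
      by apply: (is_derive_continuous (dH y _)); apply: sub; rewrite !ltW.
  rewrite Hx invrK in Dsig.
  have shift : is_derive t (1 : R) (fun t : R => H s0 - t) (-1).
    by apply: is_derive_eq (is_deriveB (is_derive_cst (H s0) t 1) (is_derive_id t 1)) _;
      rewrite sub0r.
  by have := @is_derive1_comp _ sig (fun t => H s0 - t) t _ _ Dsig shift;
    rewrite mulrN1.
have /andP[t1 t2] := tI.
have tI' : - d < t < H s0 - H 0 + d by apply/andP; split; lra.
have [/andP[x1 x2] Hx] := sigP _ (timeI t tI').
rewrite ltNge; apply/negP; rewrite le_eqVlt => /predU1P[x0|x0].
  by move: Hx; rewrite x0; lra.
have : H (sig (H s0 - t)) < H 0 by apply: Hincr => //; lra.
by rewrite Hx; lra.
Qed.

End ScalarFlow.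

(** * Speed and curvature of the spheres as functions of S *)

Section Profile.
Context {R : realType}.
(* [gk n] stands for the n-th derivative of g. *)
Variables (m : nat) (gk : nat -> R -> R).
Implicit Types S x : R.

(* With f(S) = ln S + g(S): [tangential S] = S f'(S), while [radial S] is
   (S f'(S))', the factor of the metric on the complex line of z. *)
Definition tangential S : R := 1 + S * gk 1 S.
Definition radial S : R := gk 1 S + S * gk 2 S.
Definition dradial S : R := 2 * gk 2 S + S * gk 3 S.

(** Minus the time derivative of |z|^2 on the shrinking sphere: 2 comes from differentiating |z|^2,
    and the denominator from the arithmetic mean. As f' = [tangential S] / S, the quotient (b/a)/b
    is written S / [tangential S], which is regular at 0. *)
Definition shrinking_speed S : R :=
  2 * ((m + m).-2%:R * (S / tangential S)
       + (1 + S * dradial S / radial S) / radial S) / (m + m).-1%:R.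

(* |A|^2 = [scaled_sff_norm2 S] / S on the sphere of radius sqrt S. *)
Definition scaled_sff_norm2 S : R :=
  ((m + m).-2%:R * (radial S * (S / tangential S)) ^+ 2
   + (1 + S * dradial S / radial S) ^+ 2) / radial S.

(** The neighbourhood is two-sided also at S = 0, so the functions above are continuous around 0 and
    the scalar equation makes sense for slightly negative S. *)
Hypothesis gk_derive : forall n S, 0 <= S ->
  \forall x \near S, is_derive x (1 : R) (gk n) (gk n.+1 x).

Let gd n S : 0 <= S ->
  is_derive S (1 : R) (gk n) (gk n.+1 S).
Proof. by move=> S0; exact: nbhs_singleton (gk_derive n S0). Qed.

Lemma is_derive_tangential S : 0 <= S -> is_derive S (1 : R) tangential (radial S).
Proof.
move=> S0; have d := is_derive_add (is_derive_const 1 S (1 : R))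
  (is_derive_mul (is_derive_ident S (1 : R)) (gd 1 S0)).
apply: is_derive_eq d _.
have alg (a b : R) : 0 + (1 * a + S * b) = a + S * b by ring.
exact: alg.
Qed.

Lemma is_derive_radial S : 0 <= S -> is_derive S (1 : R) radial (dradial S).
Proof.
move=> S0; have d := is_derive_add (gd 1 S0)
  (is_derive_mul (is_derive_ident S (1 : R)) (gd 2 S0)).
apply: is_derive_eq d _.
have alg (a b : R) : a + (1 * a + S * b) = 2 * a + S * b by ring.
exact: alg.
Qed.

Let near_continuous n : \forall x \near (0 : R), {for x, continuous (gk n)}.
Proof.
by apply: filterS (gk_derive n (lexx 0)) => x; exact: is_derive_continuous.
Qed.

Let near_tangential : \forall x \near (0 : R), {for x, continuous tangential}.
Proof.
apply: filterS (near_continuous 1) => x c1.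
apply: continuousD; first exact: cst_continuous.
by apply: continuousM; [exact: cvg_id | exact: c1].
Qed.

Let near_radial : \forall x \near (0 : R), {for x, continuous radial}.
Proof.
near=> x; have c1 : {for x, continuous (gk 1)} by near: x; exact: near_continuous.
have c2 : {for x, continuous (gk 2)} by near: x; exact: near_continuous.
apply: continuousD; first exact: c1.
by apply: continuousM; [exact: cvg_id | exact: c2].
Unshelve. all: by end_near. Qed.

Let near_dradial : \forall x \near (0 : R), {for x, continuous dradial}.
Proof.
near=> x; have c2 : {for x, continuous (gk 2)} by near: x; exact: near_continuous.
have c3 : {for x, continuous (gk 3)} by near: x; exact: near_continuous.
apply: continuousD; apply: continuousM.
- exact: cst_continuous.
- exact: c2.
- exact: cvg_id.
- exact: c3.
Unshelve. all: by end_near. Qed.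

Hypothesis gS0 : 0 < gk 1 0.

Let near_tangential_gt0 : \forall x \near (0 : R), 0 < tangential x.
Proof.
apply: (continuous_near_gt (h := tangential)); first exact: nbhs_singleton near_tangential.
by rewrite /tangential mul0r addr0 ltr01.
Qed.

Let near_radial_gt0 : \forall x \near (0 : R), 0 < radial x.
Proof.
apply: (continuous_near_gt (h := radial)); first exact: nbhs_singleton near_radial.
by rewrite /radial mul0r addr0.
Qed.

Let near_nonlinear : \forall x \near (0 : R),
  {for x, continuous (fun S => S / tangential S)} /\
  {for x, continuous (fun S => 1 + S * dradial S / radial S)}.
Proof.
near=> x; have ct : {for x, continuous tangential} by near: x.
have cr : {for x, continuous radial} by near: x.
have cd : {for x, continuous dradial} by near: x.
have t0 : 0 < tangential x by near: x.
have r0 : 0 < radial x by near: x.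
split.
  apply: continuousM; first exact: cvg_id.
  by apply: continuousV; [rewrite gt_eqF | exact: ct].
apply: continuousD; first exact: cst_continuous.
apply: continuousM; last by apply: continuousV; [rewrite gt_eqF | exact: cr].
by apply: continuousM; [exact: cvg_id | exact: cd].
Unshelve. all: by end_near. Qed.

Let near_shrinking_speed : \forall x \near (0 : R), {for x, continuous shrinking_speed}.
Proof.
near=> x; have cr : {for x, continuous radial} by near: x.
have r0 : 0 < radial x by near: x.
have [c1 c2] : {for x, continuous (fun S => S / tangential S)} /\
  {for x, continuous (fun S => 1 + S * dradial S / radial S)} by near: x.
apply: continuousM; last exact: cst_continuous.
apply: continuousM; first exact: cst_continuous.
apply: continuousD.
  by apply: continuousM; [exact: cst_continuous | exact: c1].
apply: continuousM; first exact: c2.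
by apply: continuousV; [rewrite gt_eqF | exact: cr].
Unshelve. all: by end_near. Qed.

Let near_scaled_sff_norm2 : \forall x \near (0 : R), {for x, continuous scaled_sff_norm2}.
Proof.
near=> x; have cr : {for x, continuous radial} by near: x.
have r0 : 0 < radial x by near: x.
have [c1 c2] : {for x, continuous (fun S => S / tangential S)} /\
  {for x, continuous (fun S => 1 + S * dradial S / radial S)} by near: x.
apply: continuousM; last by apply: continuousV; [rewrite gt_eqF | exact: cr].
apply: continuousD; last by apply: continuousM; exact: c2.
apply: continuousM; first exact: cst_continuous.
by apply: continuousM; (apply: continuousM; [exact: cr | exact: c1]).
Unshelve. all: by end_near. Qed.

(** By continuity it suffices to evaluate at S = 0, where the speed is 2 / ((2m-1) g'(0)) and the
    scaled norm is 1 / g'(0). The radius c found here determines the admissible initial radii. *)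
Lemma profile_bounds : (0 < m)%N -> exists c k l L : R,
  [/\ 0 < c, 0 < k, 0 < l & forall x, `|x| < c ->
    [/\ {for x, continuous shrinking_speed}, k < shrinking_speed x &
        l < scaled_sff_norm2 x < L]].
Proof.
move=> m0.
have r0 : radial 0 = gk 1 0 by rewrite /radial mul0r addr0.
have psi0 : 0 < shrinking_speed 0.
  have -> : shrinking_speed 0 = 2 / radial 0 / (m + m).-1%:R.
    by rewrite /shrinking_speed !mul0r mulr0 addr0 add0r div1r.
  rewrite r0 divr_gt0 ?divr_gt0 ?ltr0n //.
  by case: (m) m0 => // n _; rewrite addnS.
have K0 : 0 < scaled_sff_norm2 0.
  have -> : scaled_sff_norm2 0 = (radial 0)^-1.
    by rewrite /scaled_sff_norm2 !mul0r mulr0 expr0n /= mulr0 add0r addr0 expr1n div1r.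
  by rewrite r0 invr_gt0.
set k := shrinking_speed 0 / 2; set l := scaled_sff_norm2 0 / 2.
set L := scaled_sff_norm2 0 * 2.
have : \forall x \near (0 : R), [/\ {for x, continuous shrinking_speed},
    k < shrinking_speed x & l < scaled_sff_norm2 x < L].
  near=> x; split.
  - by near: x; exact: near_shrinking_speed.
  - near: x; apply: (continuous_near_gt (h := shrinking_speed)); last by rewrite /k; lra.
    exact: nbhs_singleton near_shrinking_speed.
  - apply/andP; split; near: x.
      apply: (continuous_near_gt (h := scaled_sff_norm2)); last by rewrite /l; lra.
      exact: nbhs_singleton near_scaled_sff_norm2.
    apply: (continuous_near_lt (h := scaled_sff_norm2)); last by rewrite /L; lra.
    exact: nbhs_singleton near_scaled_sff_norm2.
move=> /nbhs_ballP[c /= c0 cP].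
exists c, k, l, L; split=> [||| x xc]; [exact: c0|by rewrite /k; lra|by rewrite /l; lra|].
by apply: cP; rewrite /ball /= sub0r normrN.
Unshelve. all: by end_near. Qed.

Section Potential.
Local Notation f := (fun S : R => ln S + gk 0 S).

Let near_gt0 S : 0 < S -> \forall x \near S, 0 < x.
Proof. exact: lt_nbhsr. Qed.

Let is_derive_inv S : 0 < S -> is_derive S (1 : R) (fun x => x^-1) (- S ^- 2).
Proof.
move=> S0; have S0' : S != 0 by rewrite gt_eqF.
have := @is_deriveV R (fun x => x) S 1 1 S0' (is_derive_ident S 1).
by rewrite [_ *: _]mulr1.
Qed.

Lemma is_derive_potential S : 0 < S -> is_derive S (1 : R) f (S^-1 + gk 1 S).
Proof.
move=> S0; apply: is_derive_add; first exact: is_derive1_ln.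
exact: gd (ltW S0).
Qed.

Lemma derive1_potential S : 0 < S -> f^`()%classic S = S^-1 + gk 1 S.
Proof. by move=> S0; rewrite derive1E; have [_ ->] := is_derive_potential S0. Qed.

Lemma is_derive_derive1_potential S : 0 < S ->
  is_derive S (1 : R) f^`() (- S ^- 2 + gk 2 S).
Proof.
move=> S0; have d := is_derive_add (is_derive_inv S0) (gd 1 (ltW S0)).
apply: near_eq_is_derive d; apply: filterS (near_gt0 S0) => x x0.
by rewrite derive1_potential.
Qed.

Lemma derive2_potential S : 0 < S -> f^`(2)%classic S = - S ^- 2 + gk 2 S.
Proof.
by move=> S0; rewrite derive1nS derive1E; have [_ ->] := is_derive_derive1_potential S0.
Qed.

Lemma is_derive_derive2_potential S : 0 < S ->
  is_derive S (1 : R) f^`(2) (2 * S ^- 3 + gk 3 S).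
Proof.
move=> S0.
have d2 : is_derive S (1 : R) (fun x => - (x^-1 * x^-1)) (2 * S ^- 3).
  apply: is_derive_eq (is_deriveN (is_derive_mul (is_derive_inv S0) (is_derive_inv S0))) _.
  by field; rewrite gt_eqF.
apply: near_eq_is_derive (is_derive_add d2 (gd 2 (ltW S0))).
apply: filterS (near_gt0 S0) => x x0; rewrite derive2_potential //.
by rewrite -invfM -expr2.
Qed.

Lemma derive3_potential S : 0 < S -> f^`(3)%classic S = 2 * S ^- 3 + gk 3 S.
Proof.
by move=> S0; rewrite derive1nS derive1E; have [_ ->] := is_derive_derive2_potential S0.
Qed.

Lemma potential_tangential S : 0 < S -> f^`()%classic S = tangential S / S.
Proof. by move=> S0; rewrite derive1_potential // /tangential; field; rewrite gt_eqF. Qed.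

Lemma potential_radial S : 0 < S ->
  f^`()%classic S + S * f^`(2)%classic S = radial S.
Proof.
move=> S0; rewrite derive1_potential // derive2_potential // /radial.
by field; rewrite gt_eqF.
Qed.

Lemma potential_dradial S : 0 < S ->
  2 * f^`(2)%classic S + S * f^`(3)%classic S = dradial S.
Proof.
move=> S0; rewrite derive2_potential // derive3_potential // /dradial.
by field; rewrite gt_eqF.
Qed.

End Potential.
End Profile.

(** * Smoothness of the radial flow *)

Section Smoothness.
Context {R : realType}.

(** The difference quotient of a linear map is constant, so its limit exists without any continuity
    assumption. *)
Lemma is_derive_linear (E W : normedModType R) (l : E -> W) x v :
  (forall (c : R) y z, l (c *: y + z) = c *: l y + l z) -> is_derive x v l (l v).
Proof.
move=> ll.
have q : (fun h : R => h^-1 *: (l (h *: v + x) - l x)) @ (0 : R)^' --> l v.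
  apply: cvg_near_cst; near=> h.
  by rewrite ll addrK scalerA mulVf ?scale1r //; near: h; exact: nbhs_dnbhs_neq.
by apply: DeriveDef; [apply/cvg_ex; exists (l v) | exact: cvg_lim q].
Unshelve. all: by end_near. Qed.

Lemma continuous_rV (T : topologicalType) (n : nat) (h : T -> 'rV[R]_n) x :
  (forall k, {for x, continuous (fun y => h y 0 k)}) -> {for x, continuous h}.
Proof.
move=> hk; apply/cvgrPdist_le => /= e e0; near=> y.
rewrite [leLHS]/Num.Def.normr/= mx_normrE (bigmax_le _ (ltW e0))//= => -[i k] _.
rewrite !mxE ord1 /=; move: k; near: y; apply: filter_forall => k.
by have /cvgrPdist_le := hk k; exact.
Unshelve. all: by end_near. Qed.

Section Class.
Context {E : normedModType R} (U : set E) (C : set (E -> R)).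
Hypothesis U_open : open U.
Hypothesis C_continuous : forall h, C h -> forall x, U x -> {for x, continuous h}.
Hypothesis C_derive : forall h v, C h ->
  exists2 dh, C dh & forall x, U x -> is_derive x v h (dh x).

Let near_U x : U x -> \forall y \near x, U y.
Proof. by move=> Ux; apply: open_nbhs_nbhs. Qed.

(** A class of continuous functions stable under directional derivatives consists of smooth
    functions, by induction on the list of directions. Agreement on the open set U suffices, since
    derivatives are local. *)
Lemma smooth_on_class (n : nat) (h : E -> 'rV[R]_n) :
  (forall k, exists2 hk, C hk & forall x, U x -> h x 0 k = hk x) ->
  smooth_on U h.
Proof.
pose P (h : E -> 'rV[R]_n) := forall k, exists2 hk, C hk & forall x, U x -> h x 0 k = hk x.
have Pder h1 x v : P h1 -> U x -> derivable h1 x v.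
  move=> Ph1 Ux; apply/derivable_mxP => i k; rewrite ord1.
  have [hk Ck hkE] := Ph1 k; have [dh _ hd] := C_derive v Ck.
  have [d _] := hd _ Ux; apply: near_eq_derivable d.
  by apply: filterS (near_U Ux) => y Uy; rewrite hkE.
have PD h1 v : P h1 -> P ('D_v h1).
  move=> Ph1 k; have [hk Ck hkE] := Ph1 k; have [dh Cdh hd] := C_derive v Ck.
  exists dh => // x Ux; rewrite derive_mx ?mxE; last exact: Pder.
  have [_ <-] := hd _ Ux; apply: near_eq_derive.
  by apply: filterS (near_U Ux) => y Uy; rewrite hkE.
move=> Ph vs; have {}Ph : P (iter_derive h vs).
  by elim: vs => [|v vs IHvs] /=; [exact: Ph | exact: PD].
move=> x Ux; split=> [|v]; last exact: Pder.
apply: continuous_rV => k; have [hk Ck hkE] := Ph k.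
have c : hk y @[y --> x] --> hk x by exact: C_continuous Ck _ Ux.
rewrite /prop_for /continuous_at /= (hkE _ Ux).
apply: cvg_trans c; apply: near_eq_cvg.
by apply: filterS (near_U Ux) => y Uy; rewrite hkE.
Qed.

End Class.

End Smoothness.

Section RadialSmoothness.
Context {R : realType} {m : nat}.
Local Notation V := 'rV[R]_(m + m).
Variables (gk : nat -> R -> R) (S : R -> R) (l r : R).
Hypothesis gk_derive : forall n (s : R), 0 <= s ->
  \forall x \near s, is_derive x (1 : R) (gk n) (gk n.+1 x).
Hypothesis S_gt0 : forall t : R, l < t < r -> 0 < S t.
Hypothesis S_derive : forall t : R, l < t < r ->
  is_derive t (1 : R) S (- shrinking_speed m gk (S t)).
Hypothesis tangential_gt0 : forall x : R, 0 < x -> 0 < tangential gk x.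
Hypothesis radial_gt0 : forall x : R, 0 < x -> 0 < radial gk x.
Local Notation U := [set xt : V * R | xt.1 != 0 /\ l < xt.2 < r].

(** The generators are chosen so that each derivative is again a polynomial in them: S' = -psi(S)
    brings in every [gk n] and the inverses of [tangential] and [radial], while sqrt S and |x|^-1
    bring in only inverse powers already present. *)
Inductive radial_class : (V * R -> R) -> Prop :=
| rc_cst c : radial_class (fun _ => c)
| rc_coord k : radial_class (fun xt => xt.1 0 k)
| rc_norm : radial_class (fun xt => (enorm xt.1)^-1)
| rc_S : radial_class (fun xt => S xt.2)
| rc_sqrtS : radial_class (fun xt => Num.sqrt (S xt.2))
| rc_isqrtS : radial_class (fun xt => (Num.sqrt (S xt.2))^-1)
| rc_gk n : radial_class (fun xt => gk n (S xt.2))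
| rc_tangential : radial_class (fun xt => (tangential gk (S xt.2))^-1)
| rc_radial : radial_class (fun xt => (radial gk (S xt.2))^-1)
| rc_add h k : radial_class h -> radial_class k -> radial_class (fun xt => h xt + k xt)
| rc_mul h k : radial_class h -> radial_class k -> radial_class (fun xt => h xt * k xt).

Lemma rc_opp h : radial_class h -> radial_class (fun xt => - h xt).
Proof.
move=> Ch; rewrite (_ : (fun _ => _) = (fun xt => -1 * h xt)).
  exact: rc_mul (rc_cst _) Ch.
by apply/funext => xt; rewrite mulN1r.
Qed.

Lemma rc_sum (n : nat) (h : 'I_n -> V * R -> R) :
  (forall i, radial_class (h i)) -> radial_class (fun xt => \sum_i h i xt).
Proof.
elim: n h => [|n IHn] h Ch.
  rewrite (_ : (fun _ => _) = (fun xt => 0)); first exact: rc_cst.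
  by apply/funext => xt; rewrite big_ord0.
rewrite (_ : (fun _ => _) =
    (fun xt => h ord0 xt + \sum_(i < n) h (lift ord0 i) xt)).
  by apply: rc_add => //; apply: IHn.
by apply/funext => xt; rewrite big_ord_recl.
Qed.

Lemma rc_radial_part : radial_class (fun xt => radial gk (S xt.2)).
Proof. exact: rc_add (rc_gk 1) (rc_mul rc_S (rc_gk 2)). Qed.

Lemma rc_dradial : radial_class (fun xt => dradial gk (S xt.2)).
Proof.
exact: rc_add (rc_mul (rc_cst 2) (rc_gk 2)) (rc_mul rc_S (rc_gk 3)).
Qed.

Lemma rc_shrinking_speed : radial_class (fun xt => shrinking_speed m gk (S xt.2)).
Proof.
apply: rc_mul (rc_cst _); apply: rc_mul (rc_cst _) _; apply: rc_add.
  exact: rc_mul (rc_cst _) (rc_mul rc_S rc_tangential).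
apply: rc_mul rc_radial; apply: rc_add (rc_cst _) _.
exact: rc_mul (rc_mul rc_S rc_dradial) rc_radial.
Qed.

Let gkD n (x : R) : 0 < x -> is_derive x (1 : R) (gk n) (gk n.+1 x).
Proof. by move=> x0; exact: nbhs_singleton (gk_derive n (ltW x0)). Qed.

Lemma is_derive_invf (E : normedModType R) (h : E -> R) x v dh : h x != 0 ->
  is_derive x v h dh ->
  is_derive x v (fun y => (h y)^-1) (-1 * ((h x)^-1 * (h x)^-1 * dh)).
Proof.
move=> hx [d <-]; apply: DeriveDef; first exact: derivableV.
rewrite deriveV //; have alg (a b : R) : - a ^- 2 * b = -1 * (a^-1 * a^-1 * b).
  by rewrite mulN1r mulNr -invfM -expr2.
exact: alg.
Qed.

Lemma is_derive_sqrtf (E : normedModType R) (h : E -> R) x v dh : 0 < h x ->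
  is_derive x v h dh ->
  is_derive x v (fun y => Num.sqrt (h y)) (2^-1 * (Num.sqrt (h x))^-1 * dh).
Proof.
move=> hx d; apply: is_derive_eq (is_derive_chain d (is_derive1_sqrt hx)) _.
by rewrite invfM.
Qed.

Lemma radial_class_derive h v : radial_class h ->
  exists2 dh, radial_class dh & forall xt, U xt -> is_derive xt v h (dh xt).
Proof.
have snd_d (xt : V * R) : is_derive xt v (fun xt : V * R => xt.2) v.2.
  exact: is_derive_linear.
have fst_d (xt : V * R) : is_derive xt v (fun xt : V * R => xt.1) v.1.
  exact: is_derive_linear.
have Sd xt : U xt -> is_derive xt v (fun xt : V * R => S xt.2)
    (- shrinking_speed m gk (S xt.2) * v.2).
  by move=> [_ tI]; apply: is_derive_chain (snd_d xt) (S_derive tI).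
have S0 (xt : V * R) : U xt -> 0 < S xt.2 by move=> [_ /S_gt0].
have sqrtS0 (xt : V * R) : U xt -> Num.sqrt (S xt.2) != 0.
  by move=> /S0 ?; rewrite gt_eqF // sqrtr_gt0.
have CdS : radial_class (fun xt => - shrinking_speed m gk (S xt.2) * v.2).
  exact: rc_mul (rc_opp rc_shrinking_speed) (rc_cst _).
elim=> {h} [c|k||||||||h k _ [dh Cdh hd] _ [dk Cdk kd]|h k Ch [dh Cdh hd] Ck [dk Cdk kd]].
- exists (fun _ => 0); first exact: rc_cst.
  by move=> xt _; exact: is_derive_const.
- exists (fun _ => v.1 0 k); first exact: rc_cst.
  by move=> xt _; exact: (is_derive_rV _ _ _ _).1 (fst_d xt) k.
- exists (fun xt => -1 * ((enorm xt.1)^-1 * (enorm xt.1)^-1 *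
      (2^-1 * (enorm xt.1)^-1 * (2 * \sum_k v.1 0 k * xt.1 0 k)))).
    apply: rc_mul (rc_cst _) (rc_mul (rc_mul rc_norm rc_norm) _).
    apply: rc_mul (rc_mul (rc_cst _) rc_norm) (rc_mul (rc_cst _) _).
    by apply: rc_sum => k; exact: rc_mul (rc_cst _) (rc_coord k).
  move=> xt [x0 _]; apply: is_derive_invf; first by rewrite enorm_eq0.
  apply: is_derive_sqrtf; first by rewrite radius2_gt0.
  exact: is_derive_radius2.
- by exists (fun xt => - shrinking_speed m gk (S xt.2) * v.2).
- exists (fun xt => 2^-1 * (Num.sqrt (S xt.2))^-1 * (- shrinking_speed m gk (S xt.2) * v.2)).
    exact: rc_mul (rc_mul (rc_cst _) rc_isqrtS) CdS.
  by move=> xt Ut; apply: is_derive_sqrtf; [exact: S0 | exact: Sd].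
- exists (fun xt => -1 * ((Num.sqrt (S xt.2))^-1 * (Num.sqrt (S xt.2))^-1 *
      (2^-1 * (Num.sqrt (S xt.2))^-1 * (- shrinking_speed m gk (S xt.2) * v.2)))).
    apply: rc_mul (rc_cst _) (rc_mul (rc_mul rc_isqrtS rc_isqrtS) _).
    exact: rc_mul (rc_mul (rc_cst _) rc_isqrtS) CdS.
  move=> xt Ut; apply: is_derive_invf; first exact: sqrtS0.
  by apply: is_derive_sqrtf; [exact: S0 | exact: Sd].
- move=> n.
  exists (fun xt => gk n.+1 (S xt.2) * (- shrinking_speed m gk (S xt.2) * v.2)).
    exact: rc_mul (rc_gk _) CdS.
  by move=> xt Ut; apply: is_derive_chain (Sd _ Ut) (gkD n (S0 _ Ut)).
- exists (fun xt => -1 * ((tangential gk (S xt.2))^-1 * (tangential gk (S xt.2))^-1 *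
      (radial gk (S xt.2) * (- shrinking_speed m gk (S xt.2) * v.2)))).
    apply: rc_mul (rc_cst _) (rc_mul (rc_mul rc_tangential rc_tangential) _).
    exact: rc_mul rc_radial_part CdS.
  move=> xt Ut; apply: is_derive_invf; first by rewrite gt_eqF // tangential_gt0 // S0.
  apply: is_derive_chain (Sd _ Ut) _.
  by apply: is_derive_tangential => //; rewrite ltW // S0.
- exists (fun xt => -1 * ((radial gk (S xt.2))^-1 * (radial gk (S xt.2))^-1 *
      (dradial gk (S xt.2) * (- shrinking_speed m gk (S xt.2) * v.2)))).
    apply: rc_mul (rc_cst _) (rc_mul (rc_mul rc_radial rc_radial) _).
    exact: rc_mul rc_dradial CdS.
  move=> xt Ut; apply: is_derive_invf; first by rewrite gt_eqF // radial_gt0 // S0.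
  apply: is_derive_chain (Sd _ Ut) _.
  by apply: is_derive_radial => //; rewrite ltW // S0.
- exists (fun xt => dh xt + dk xt); first exact: rc_add.
  by move=> xt Ut; apply: is_derive_add; [exact: hd | exact: kd].
- exists (fun xt => dh xt * k xt + h xt * dk xt).
    by apply: rc_add; apply: rc_mul.
  by move=> xt Ut; apply: is_derive_mul; [exact: hd | exact: kd].
Qed.

Lemma radius2_continuous : continuous (@radius2 R m).
Proof.
move=> x; have c k : {for x, continuous (fun y : V => y 0 k)}.
  exact: coord_continuous.
rewrite /radius2 /edot; elim: (index_enum _) => [|k s IHs].
  rewrite (_ : (fun _ => _) = (fun=> 0)); first exact: cst_continuous.
  by apply/funext => y; rewrite big_nil.
rewrite (_ : (fun _ => _) = (fun y : V => y 0 k * y 0 k + \sum_(i <- s) y 0 i * y 0 i)).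
  by apply: continuousD IHs; exact: continuousM (c k) (c k).
by apply/funext => y; rewrite big_cons.
Qed.

Lemma enorm_continuous : continuous (@enorm R m).
Proof.
move=> x; apply: continuous_comp; first exact: radius2_continuous.
exact: sqrt_continuous.
Qed.

Lemma radial_class_continuous h : radial_class h ->
  forall xt, U xt -> {for xt, continuous h}.
Proof.
move=> Ch xt Ut.
have snd_c : {for xt, continuous (fun xt : V * R => xt.2)} by exact: cvg_snd.
have fst_c : {for xt, continuous (fun xt : V * R => xt.1)} by exact: cvg_fst.
have S0 : 0 < S xt.2 by have [_ /S_gt0] := Ut.
have Sc : {for xt, continuous (fun xt : V * R => S xt.2)}.
  by apply: (continuous_comp snd_c); have [_ /S_derive/is_derive_continuous] := Ut.
have sqrtSc : {for xt, continuous (fun xt : V * R => Num.sqrt (S xt.2))}.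
  by apply: (continuous_comp Sc); exact: sqrt_continuous.
have comp1 (phi : V -> R) : {for xt.1, continuous phi} ->
    {for xt, continuous (fun y : V * R => phi y.1)} by exact: continuous_comp.
have compS (phi : R -> R) : {for S xt.2, continuous phi} ->
    {for xt, continuous (fun y : V * R => phi (S y.2))}.
  by move=> c; exact: (continuous_comp Sc c).
elim: Ch => {h} [c|k|||||n|||h k _ hc _ kc|h k _ hc _ kc].
- exact: cst_continuous.
- by apply: (comp1 (fun y => y 0 k)); exact: coord_continuous.
- apply: continuousV; first by rewrite enorm_eq0; case: Ut.
  by apply: (comp1 (@enorm R m)); exact: enorm_continuous.
- exact: Sc.
- exact: sqrtSc.
- by apply: continuousV; [rewrite gt_eqF // sqrtr_gt0 | exact: sqrtSc].
- by apply: (compS (gk n)); exact: is_derive_continuous (gkD n S0).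
- apply: continuousV; first by rewrite gt_eqF // tangential_gt0.
  apply: (compS (tangential gk)); exact: is_derive_continuous (is_derive_tangential gk_derive (ltW S0)).
- apply: continuousV; first by rewrite gt_eqF // radial_gt0.
  apply: (compS (radial gk)); exact: is_derive_continuous (is_derive_radial gk_derive (ltW S0)).
- exact: continuousD.
- exact: continuousM.
Qed.

Lemma open_punctured_times_itv : open U.
Proof.
rewrite openE => -[x t] /= [x0 tI]; rewrite /interior /=.
have n1 : nbhs x [set y : V | y != 0].
  have : \forall y \near x, 0 < enorm y.
    by apply: continuous_near_gt; [exact: enorm_continuous | rewrite enorm_gt0].
  by apply: filterS => y; rewrite enorm_gt0.
have n2 : nbhs t [set s : R | l < s < r].
  have : `]l, r[ t by rewrite /= in_itv.
  by move=> /near_in_itvoo; apply: filterS => s; rewrite in_itv.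
exists ([set y : V | y != 0], [set s : R | l < s < r]) => //.
Qed.

Lemma radial_smooth : smooth_on U
  (fun xt : V * R => (Num.sqrt (S xt.2) / enorm xt.1) *: xt.1).
Proof.
apply: (smooth_on_class open_punctured_times_itv radial_class_continuous
  radial_class_derive) => k.
exists (fun xt : V * R => Num.sqrt (S xt.2) * (enorm xt.1)^-1 * xt.1 0 k).
  exact: rc_mul (rc_mul rc_sqrtS rc_norm) (rc_coord k).
by move=> xt _; rewrite mxE.
Qed.

End RadialSmoothness.

(** * Regularity of flows and geometry of the potential *)

Section TimeSlices.
Context {R : realType} {V W : normedModType R}.
Implicit Types (Phi : V * R -> W) (x v : V) (t : R).

Lemma line_space x v t (s : R) : s *: ((v, 0) : V * R) + (x, t) = (s *: v + x, t).
Proof. by rewrite -[LHS]/(s *: v + x, s *: 0 + t) scaler0 add0r. Qed.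

Lemma line_time x t (s : R) : s *: ((0, 1) : V * R) + (x, t) = (x, s *: 1 + t).
Proof. by rewrite -[LHS]/(s *: 0 + x, s *: 1 + t) scaler0 add0r. Qed.

Lemma derivable_slice Phi x v t :
  derivable Phi (x, t) (v, 0) -> derivable (fun y => Phi (y, t)) x v.
Proof.
move=> /derivable1P d; apply/derivable1P.
rewrite (_ : (fun _ => _) = (fun s : R => Phi (s *: (v, 0) + (x, t)))) //.
by apply/funext => s; rewrite line_space.
Qed.

Lemma derive_slice Phi x v t : 'D_(v, 0) Phi (x, t) = 'D_v (fun y => Phi (y, t)) x.
Proof.
rewrite /derive; set g1 := fun s => _; set g2 := fun s => _.
by suff -> : g1 = g2 by []; apply/funext => s; rewrite /g1 /g2 /= line_space.
Qed.

Lemma derivable_time Phi x t :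
  derivable Phi (x, t) (0, 1) -> derivable (fun s => Phi (x, s)) t 1.
Proof.
move=> /derivable1P d; apply/derivable1P.
rewrite (_ : (fun _ => _) = (fun s : R => Phi (s *: (0, 1) + (x, t)))) //.
by apply/funext => s; rewrite line_time.
Qed.

End TimeSlices.

Section FlowRegularity.
Context {R : realType} {m : nat}.
Local Notation V := 'rV[R]_(m + m).
Variables (R0 : R) (F : V -> R -> V) (l r : R).
Hypothesis F_smooth : smooth_on [set xt : V * R | xt.1 != 0 /\ l < xt.2 < r]
  (fun xt : V * R => ray_ext R0 F xt.2 xt.1).

Lemma ray_ext_derivable t x w : l < t < r -> x != 0 ->
  derivable (ray_ext R0 F t) x w.
Proof.
move=> tI x0; have [_ /(_ (w, 0)) d] := F_smooth [::] (x := (x, t)) (conj x0 tI).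
exact: derivable_slice d.
Qed.

Lemma derive_ray_ext_derivable t x v w : l < t < r -> x != 0 ->
  derivable ('D_w (ray_ext R0 F t)) x v.
Proof.
move=> tI x0.
have [_ /(_ (v, 0)) d] := F_smooth [:: (w, 0)] (x := (x, t)) (conj x0 tI).
rewrite (_ : 'D_w _ = (fun y => 'D_(w, 0) (fun xt : V * R => ray_ext R0 F xt.2 xt.1) (y, t))).
  exact: derivable_slice d.
by apply/funext => y; rewrite derive_slice.
Qed.

Lemma ray_ext_continuous t x : l < t < r -> x != 0 ->
  {for (x, t), continuous (fun xt : V * R => ray_ext R0 F xt.2 xt.1)}.
Proof. by move=> tI x0; have [] := F_smooth [::] (x := (x, t)) (conj x0 tI). Qed.

Hypothesis R0_gt0 : 0 < R0.

Lemma sphere_neq0 (p : V) : hypersphere R0 p -> p != 0.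
Proof. by move=> /= pR; rewrite -enorm_gt0 pR. Qed.

Lemma ray_ext_on_sphere (p : V) t : hypersphere R0 p -> ray_ext R0 F t p = F p t.
Proof. by move=> pR; exact: ray_ext_sphere. Qed.

Lemma flow_derivable (p : V) t : hypersphere R0 p -> l < t < r -> derivable (F p) t 1.
Proof.
move=> pR tI; have p0 := sphere_neq0 pR.
have [_ /(_ (0, 1)) d] := F_smooth [::] (x := (p, t)) (conj p0 tI).
have dt := derivable_time d.
rewrite (_ : F p = (fun s => ray_ext R0 F s p)); first exact: dt.
by apply/funext => s; rewrite ray_ext_on_sphere.
Qed.

End FlowRegularity.

Lemma hypersphere_nonempty (R : realType) (m : nat) (r : R) :
  (0 < m)%N -> 0 < r -> exists p : 'rV[R]_(m + m), hypersphere r p.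
Proof.
move=> m0 r0; pose k : 'I_(m + m) := lshift m (Ordinal m0).
exists (r *: basis_vec k); rewrite /hypersphere /= enormZ gtr0_norm //.
by rewrite /enorm /radius2 edot_basis mxE !eqxx sqrtr1 mulr1.
Qed.

Section PotentialGeometry.
Context {R : realType} {m : nat}.
Local Notation V := 'rV[R]_(m + m).
Variables (gk : nat -> R -> R).
Hypothesis gk_derive : forall n (s : R), 0 <= s ->
  \forall x \near s, is_derive x (1 : R) (gk n) (gk n.+1 x).
Hypothesis tangential_gt0 : forall x : R, 0 < x -> 0 < tangential gk x.
Hypothesis radial_gt0 : forall x : R, 0 < x -> 0 < radial gk x.
Hypothesis m_gt0 : (0 < m)%N.
Local Notation f := (fun S : R => ln S + gk 0 S).

Lemma potential_derive1_gt0 (S : R) : 0 < S -> 0 < f^`()%classic S.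
Proof.
by move=> S0; rewrite potential_tangential // divr_gt0 // tangential_gt0.
Qed.

Lemma potential_radial_gt0 (S : R) : 0 < S ->
  0 < f^`()%classic S + S * f^`(2)%classic S.
Proof. by move=> S0; rewrite potential_radial // radial_gt0. Qed.

Lemma potential_derivable1 (S : R) : 0 < S -> derivable f^`() S 1.
Proof. by move=> S0; have [] := is_derive_derive1_potential gk_derive S0. Qed.

Lemma potential_derivable2 (S : R) : 0 < S -> derivable f^`(2) S 1.
Proof. by move=> S0; have [] := is_derive_derive2_potential gk_derive S0. Qed.

Section AtPoint.
Variables (R0 : R) (F : V -> R -> V) (t : R) (p : V).
Hypothesis R0_gt0 : 0 < R0.
Hypothesis p_sphere : hypersphere R0 p.
Hypothesis q_neq0 : F p t != 0.
Hypothesis G_derivable : forall w, \forall y \near p, derivable (ray_ext R0 F t) y w.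
Hypothesis DG_derivable : forall v w, derivable ('D_w (ray_ext R0 F t)) p v.
Hypothesis dF_tangent : forall v, tangent p v ->
  edot (differential R0 F t p v) (F p t) = 0.
Local Notation S := (radius2 (F p t)).
Local Notation u := (fun y => radius2 (ray_ext R0 F t y)).

Let S_gt0 : 0 < S. Proof. by rewrite radius2_gt0. Qed.

Lemma mean_curvature_speed n H :
  unit_normal f R0 F t p n -> mean_curvature f R0 F t p n H ->
  exists s (e : 'I_(m + m).-1 -> V), [/\ n = s *: F p t,
    forall i, tangent p (e i) &
    2 * edot (H *: n) (F p t) =
      (\sum_i 'D_(e i) ('D_(e i) u) p) / (m + m).-1%:R - shrinking_speed m gk S].
Proof.
move=> nn nH.
have [s [e [nE eT ->]]] := mean_curvature_radial_speed m_gt0 R0_gt0 p_sphere q_neq0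
  (potential_derive1_gt0 S_gt0) (potential_radial_gt0 S_gt0)
  (potential_derivable1 S_gt0) (potential_derivable2 S_gt0)
  G_derivable DG_derivable nn nH dF_tangent.
exists s, e; split => //.
rewrite potential_radial // potential_dradial // potential_tangential //.
rewrite /shrinking_speed.
move: (radial_gt0 S_gt0) (tangential_gt0 S_gt0) (S_gt0) => r0 t0 s0.
have alg (D N M a b c x : R) : a != 0 -> b != 0 -> x != 0 ->
   (D - 2 * (N * (b / (a / x)) + (1 + x * c / b)) / b) * M =
   D * M - 2 * (N * (x / a) + (1 + x * c / b) / b) * M.
  by move=> a0 b0 x0; field; rewrite a0 b0 x0.
by apply: alg; rewrite gt_eqF.
Qed.

Lemma sff_norm2_value A2 :
  (forall v w, 'D_v ('D_w u) p = 0) ->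
  sff_norm2 f R0 F t p A2 -> A2 = scaled_sff_norm2 m gk S / S.
Proof.
move=> DDu [n [e [nn eo ->]]].
have [s nE s2] := unit_normal_radial m_gt0 q_neq0
  (potential_derive1_gt0 S_gt0) (potential_radial_gt0 S_gt0) eo dF_tangent nn.
rewrite nE (sqr_norm_second_fundamental_form m_gt0 R0_gt0 p_sphere q_neq0
  (potential_derive1_gt0 S_gt0) (potential_radial_gt0 S_gt0)
  (potential_derivable1 S_gt0) (potential_derivable2 S_gt0)
  G_derivable DG_derivable eo dF_tangent s2) => [|i j]; last exact: DDu.
rewrite potential_radial // potential_dradial // potential_tangential //.
rewrite /scaled_sff_norm2.
move: (radial_gt0 S_gt0) (tangential_gt0 S_gt0) (S_gt0) => r0 t0 s0.
have alg (N a b c x : R) : a != 0 -> b != 0 -> x != 0 ->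
   (N * (b / (a / x)) ^+ 2 + (1 + x * c / b) ^+ 2) / b / x =
   (N * (b * (x / a)) ^+ 2 + (1 + x * c / b) ^+ 2) / b / x.
  by move=> a0 b0 x0; field; rewrite a0 b0 x0.
by apply: alg; rewrite gt_eqF.
Qed.

End AtPoint.
End PotentialGeometry.

(** Complete z/|z| and Jz/|z| to an orthonormal basis and drop the first vector. Only one remaining
    vector pairs with Jz, so the rank-one Hopf term is diagonal in this frame. *)
Lemma hopf_frame (R : realType) (m : nat) (z : 'rV[R]_(m + m)) :
  (0 < m)%N -> z != 0 ->
  exists e : 'I_(m + m).-1 -> 'rV[R]_(m + m),
    [/\ forall i, edot (e i) z = 0,
        forall i j, edot (e i) (e j) = (i == j)%:R &
        forall i j, i != j -> edot (e i) (Jmul z) * edot (e j) (Jmul z) = 0].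
Proof.
move=> m0 z0.
have N0 : enorm z != 0 by rewrite enorm_eq0.
have NN : edot z z = enorm z ^+ 2 by rewrite sqr_enorm.
pose E (i : 'I_2) := (enorm z)^-1 *: (if i == 0 then z else Jmul z).
have EE i j : edot (E i) (E j) = (i == j)%:R.
  rewrite /E edotZl edotZr.
  case: i => -[|[|//]] ?; case: j => -[|[|//]] ?; rewrite -!val_eqE /=.
  - by rewrite NN; field.
  - by rewrite edot_Jmul0 !mulr0.
  - by rewrite edotC edot_Jmul0 !mulr0.
  - by rewrite edot_JmulJmul NN; field.
have mE : (2 + (m + m).-2 = m + m)%N.
  by case: (m) m0 => // k _; rewrite addnS addSn.
have [|E' [E'l E'E']] := @orthonormal_completion R m 2 (m + m).-2 E _ EE.
  by rewrite mE.
have mE' : ((m + m).-1.+1 = 2 + (m + m).-2)%N.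
  by rewrite mE prednK // addn_gt0 m0.
(* [lift ord0] skips index 0, the position of z/|z|. *)
pose idx (i : 'I_(m + m).-1) := cast_ord mE' (lift ord0 i).
have idx_inj i j : (idx i == idx j) = (i == j).
  by rewrite (inj_eq (@cast_ord_inj _ _ mE')) (inj_eq lift_inj).
pose i0 : 'I_(2 + (m + m).-2) := lshift _ (0 : 'I_2).
pose i1 : 'I_(2 + (m + m).-2) := lshift _ (1 : 'I_2).
have zE : z = enorm z *: E' i0.
  by rewrite E'l /E eqxx scalerA mulfV // scale1r.
have JzE : Jmul z = enorm z *: E' i1.
  by rewrite E'l /E /= scalerA mulfV // scale1r.
exists (fun i => E' (idx i)); split=> [i|i j|i j ij].
- by rewrite [X in edot _ X]zE edotZr E'E' -val_eqE /= mulr0.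
- by rewrite E'E' idx_inj.
- rewrite JzE !edotZr !E'E'.
  have [ii1|_] := eqVneq (idx i) i1; last by rewrite mulr0 mul0r.
  have [ji1|_] := eqVneq (idx j) i1; last by rewrite !mulr0.
  by move: ij; rewrite -idx_inj ii1 ji1 eqxx.
Qed.

(** * The shrinking spheres *)

Section ShrinkingSphere.
Context {R : realType} {m : nat}.
Local Notation V := 'rV[R]_(m + m).
Variables (gk : nat -> R -> R).
Hypothesis gk_derive : forall n (s : R), 0 <= s ->
  \forall x \near s, is_derive x (1 : R) (gk n) (gk n.+1 x).
Hypothesis tangential_gt0 : forall x : R, 0 < x -> 0 < tangential gk x.
Hypothesis radial_gt0 : forall x : R, 0 < x -> 0 < radial gk x.
Hypothesis m_gt0 : (0 < m)%N.
Local Notation f := (fun S : R => ln S + gk 0 S).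
Variables (R0 T d : R) (S : R -> R).
Hypothesis R0_gt0 : 0 < R0.
Hypothesis T_gt0 : 0 < T.
Hypothesis d_gt0 : 0 < d.
Hypothesis S0 : S 0 = R0 ^+ 2.
Hypothesis ST : S T = 0.
Hypothesis S_derive : forall t : R, - d < t < T + d ->
  is_derive t (1 : R) S (- shrinking_speed m gk (S t)).
Hypothesis S_gt0 : forall t : R, - d < t < T -> 0 < S t.

Definition sphere_flow (p : V) (t : R) : V := (Num.sqrt (S t) / R0) *: p.
Local Notation F := sphere_flow.

Let R0_neq0 : R0 != 0. Proof. by rewrite gt_eqF. Qed.

Let timeI t : 0 <= t < T -> - d < t < T.
Proof.
move=> /andP[t0 tT]; rewrite tT andbT; apply: lt_le_trans t0.
by rewrite oppr_lt0.
Qed.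

Let timeS_gt0 t : 0 <= t < T -> 0 < S t.
Proof. by move=> /timeI /S_gt0. Qed.

Let sqrtS_gt0 t : 0 <= t < T -> 0 < Num.sqrt (S t).
Proof. by move=> /timeS_gt0; rewrite sqrtr_gt0. Qed.

Lemma ray_ext_sphere_flow t x : ray_ext R0 F t x = (Num.sqrt (S t) / enorm x) *: x.
Proof.
by rewrite /ray_ext /sphere_flow scalerA; congr (_ *: _); rewrite mulrA divfK.
Qed.

Lemma radius2_ray_ext_sphere_flow t x : 0 <= t < T -> x != 0 ->
  radius2 (ray_ext R0 F t x) = S t.
Proof.
move=> tI x0; rewrite ray_ext_sphere_flow radius2Z exprMn sqr_sqrtr; last first.
  by rewrite ltW // timeS_gt0.
by rewrite -sqr_enorm exprVn divfK // sqrf_eq0 enorm_eq0.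
Qed.

Lemma radius2_sphere_flow t p : 0 <= t < T -> hypersphere R0 p ->
  radius2 (F p t) = S t.
Proof.
move=> tI pR; rewrite -(ray_ext_on_sphere F R0_gt0 t pR).
by rewrite radius2_ray_ext_sphere_flow // (sphere_neq0 R0_gt0 pR).
Qed.

Lemma enorm_sphere_flow t p : 0 <= t < T -> hypersphere R0 p ->
  enorm (F p t) = Num.sqrt (S t).
Proof. by move=> tI pR; rewrite /enorm radius2_sphere_flow. Qed.

Lemma sphere_flow_neq0 t p : 0 <= t < T -> hypersphere R0 p -> F p t != 0.
Proof. by move=> tI pR; rewrite -radius2_gt0 radius2_sphere_flow // timeS_gt0. Qed.

Lemma derive2_radius2_sphere_flow t p v w : 0 <= t < T -> p != 0 ->
  'D_v ('D_w (fun y => radius2 (ray_ext R0 F t y))) p = 0.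
Proof.
move=> tI p0.
have near0 (x : V) : x != 0 -> \forall y \near x, y != 0.
  rewrite -enorm_gt0 => x0; have := continuous_near_gt (@enorm_continuous R m x) x0.
  by apply: filterS => y; rewrite enorm_gt0.
have D1 (x : V) : x != 0 ->
    'D_w (fun y => radius2 (ray_ext R0 F t y)) x = 0.
  move=> x0; rewrite -(derive_cst (S t) x w); apply: near_eq_derive.
  by apply: filterS (near0 x x0) => y y0; rewrite radius2_ray_ext_sphere_flow.
rewrite -(derive_cst (0 : R) p v); apply: near_eq_derive.
by apply: filterS (near0 p p0) => y y0; rewrite D1.
Qed.

Lemma sphere_flow_smooth :
  smooth_on [set xt : V * R | xt.1 != 0 /\ - d < xt.2 < T]
    (fun xt : V * R => ray_ext R0 F xt.2 xt.1).
Proof.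
rewrite (_ : (fun _ => _) =
  (fun xt : V * R => (Num.sqrt (S xt.2) / enorm xt.1) *: xt.1)).
  apply: (radial_smooth gk_derive) => // t /andP[t1 t2]; apply: S_derive.
  by rewrite t1 /= (lt_trans t2) // ltrDl.
by apply/funext => xt; rewrite ray_ext_sphere_flow.
Qed.

Lemma differential_sphere_flow t p v : hypersphere R0 p -> tangent p v ->
  differential R0 F t p v = (Num.sqrt (S t) / R0) *: v.
Proof.
move=> pR pv; have p0 := sphere_neq0 R0_gt0 pR.
rewrite /differential (_ : ray_ext R0 F t =
  (fun x => (Num.sqrt (S t) / enorm x) *: x)); last first.
  by apply/funext => x; rewrite ray_ext_sphere_flow.
have pR' : enorm p = R0 by [].
(* Along a tangent direction |x| is constant to first order, so the derivative falls on x alone. *)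
have dn : is_derive p v (fun x : V => (enorm x)^-1) 0.
  have d1 := is_derive_radius2 (is_derive_ident p v).
  have d2 : is_derive p v (@enorm R m) (2^-1 * (enorm p)^-1 * (2 * edot v p)).
    by apply: is_derive_sqrtf d1; rewrite radius2_gt0.
  apply: is_derive_eq (is_derive_invf _ d2) _; first by rewrite enorm_eq0.
  by rewrite edotC pv !mulr0.
suff [_ //] : is_derive p v (fun x => (Num.sqrt (S t) / enorm x) *: x)
    ((Num.sqrt (S t) / R0) *: v).
apply/is_derive_rV => k; under eq_fun do rewrite mxE; rewrite mxE.
have dk := (is_derive_rV _ _ _ _).1 (is_derive_ident p v) k.
apply: is_derive_eq
  (is_derive_mul (is_derive_mul (is_derive_const (Num.sqrt (S t)) p v) dn) dk) _.
by rewrite mul0r mulr0 add0r mul0r add0r pR'.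
Qed.

Lemma differential_sphere_flow_tangent t p v : hypersphere R0 p -> tangent p v ->
  edot (differential R0 F t p v) (F p t) = 0.
Proof.
move=> pR pv; rewrite differential_sphere_flow // /sphere_flow edotZl edotZr.
by rewrite edotC pv !mulr0.
Qed.

Let G_derivable t p : 0 <= t < T -> hypersphere R0 p ->
  forall w, \forall y \near p, derivable (ray_ext R0 F t) y w.
Proof.
move=> tI pR w.
have p0 : 0 < enorm p by rewrite enorm_gt0 (sphere_neq0 R0_gt0 pR).
have := continuous_near_gt (@enorm_continuous R m p) p0.
apply: filterS => y; rewrite enorm_gt0 => y0.
exact: (ray_ext_derivable sphere_flow_smooth (timeI tI) y0).
Qed.

Let DG_derivable t p : 0 <= t < T -> hypersphere R0 p ->
  forall v w, derivable ('D_w (ray_ext R0 F t)) p v.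
Proof.
move=> tI pR v w.
exact: (derive_ray_ext_derivable sphere_flow_smooth (timeI tI) (sphere_neq0 R0_gt0 pR)).
Qed.

(** The radial vector F has squared length S b in the metric, so this factor normalizes it. *)
Definition outward_scale t : R := (Num.sqrt (S t * radial gk (S t)))^-1.
Definition outward_normal (p : V) (t : R) : V := outward_scale t *: F p t.

Lemma outward_scaleE t : 0 <= t < T ->
  outward_scale t ^+ 2 * S t * radial gk (S t) = 1.
Proof.
move=> tI; have s0 := timeS_gt0 tI; have b0 := radial_gt0 s0.
rewrite exprVn sqr_sqrtr; last by rewrite ltW // mulr_gt0.
by rewrite -mulrA mulVf // mulf_neq0 // gt_eqF.
Qed.

Lemma outward_normal_unit t p : 0 <= t < T -> hypersphere R0 p ->
  unit_normal f R0 F t p (outward_normal p t).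
Proof.
move=> tI pR; have s0 := timeS_gt0 tI; split.
  rewrite metricE hformZl hformZr hform_radial -/(radius2 _).
  rewrite radius2_sphere_flow // potential_radial //.
  by rewrite -(outward_scaleE tI); ring.
move=> v pv; rewrite metricE hformZr hform_radial.
by rewrite differential_sphere_flow_tangent // !mulr0.
Qed.

(** The Hopf frame is orthogonal for the metric and diagonalizes the second fundamental form.
    Rescaling its vectors makes it orthonormal, and the principal curvatures are simply read off on
    the diagonal. *)
Lemma sphere_flow_principal_frame t p : 0 <= t < T -> hypersphere R0 p ->
  exists e kappa, orthonormal_frame f R0 F t p e /\
    forall a b, second_fundamental_form f R0 F t p (outward_normal p t) (e a) (e b)
                = kappa a *+ (a == b).
Proof.
move=> tI pR; have s0 := timeS_gt0 tI.
have p0 := sphere_neq0 R0_gt0 pR; have q0 := sphere_flow_neq0 tI pR.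
have q2 := radius2_sphere_flow tI pR.
have [e0 [e0p e0e0 e0J]] := hopf_frame m_gt0 p0.
pose c : R := Num.sqrt (S t) / R0.
have c0 : c != 0 by rewrite /c mulf_neq0 ?invr_eq0 // gt_eqF // sqrtS_gt0.
pose X i := c *: e0 i.
pose h := hermitian_form (f^`()%classic (S t)) (f^`(2)%classic (S t)) (F p t).
have X_neq0 i : X i != 0.
  rewrite scaler_eq0 negb_or c0 /= -radius2_eq0 /radius2 e0e0 eqxx.
  exact: oner_neq0.
have h0 i : 0 < h (X i) (X i).
  apply: hform_gt0 => //; first exact: potential_derive1_gt0.
  by rewrite q2; exact: potential_radial_gt0.
have J0 i j : i != j -> edot (X i) (Jmul (F p t)) * edot (X j) (Jmul (F p t)) = 0.
  move=> ij; rewrite /X /sphere_flow JmulZ !edotZl !edotZr.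
  have alg (x y : R) : x * y = 0 -> c * (c * x) * (c * (c * y)) = 0.
    by move=> xy; transitivity (c ^+ 4 * (x * y)); [ring | rewrite xy mulr0].
  by apply: alg; exact: e0J.
have XX i j : i != j -> edot (X i) (X j) = 0.
  by move=> ij; rewrite edotZl edotZr e0e0 (negbTE ij) !mulr0.
have Xq i : edot (X i) (F p t) = 0 by rewrite edotZl edotZr e0p !mulr0.
have hX i j : i != j -> h (X i) (X j) = 0.
  by move=> ij; rewrite /h /hermitian_form XX // J0 // !Xq !mulr0 addr0 mulr0 addr0.
pose k i : R := (Num.sqrt (h (X i) (X i)))^-1.
pose e i := k i *: e0 i.
have eT i : tangent p (e i) by rewrite /tangent edotZr edotC e0p mulr0.
have dE i : differential R0 F t p (e i) = k i *: X i.
  by rewrite differential_sphere_flow // /X !scalerA mulrC.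
clearbody X.
exists e, (fun i => second_fundamental_form f R0 F t p (outward_normal p t) (e i) (e i)).
split.
  split=> // i j; rewrite !dE metricE q2 hformZl hformZr -/(h _ _).
  have [<-|ij] := eqVneq i j; last by rewrite hX // !mulr0.
  by rewrite mulrA -expr2 exprVn sqr_sqrtr ?(ltW (h0 i)) // mulVf // gt_eqF.
move=> i j; have [<-//|ij] := eqVneq i j; rewrite mulr0n.
have qS : 0 < radius2 (F p t) by rewrite q2.
rewrite second_fundamental_form_radial //.
- rewrite (derive2_radius2_sphere_flow _ _ tI p0) !dE !edotZl !edotZr XX //.
  have alg (s B C x y z w : R) : x * y = 0 ->
      s * (B / 2 * 0 - B * (z * (w * 0)) - C * (z * x) * (w * y)) = 0.
    move=> xy; transitivity (- s * C * z * w * (x * y)); first by ring.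
    by rewrite xy mulr0.
  by apply: alg; exact: J0.
- exact: potential_derive1_gt0.
- exact: potential_radial_gt0.
- exact: potential_derivable1.
- exact: potential_derivable2.
- exact: G_derivable.
- exact: DG_derivable.
- by rewrite dE edotZl Xq mulr0.
- by rewrite dE edotZl Xq mulr0.
Qed.

Lemma sphere_flow_velocity p t : 0 <= t < T ->
  (F p)^`()%classic t = (- shrinking_speed m gk (S t) / (2 * S t)) *: F p t.
Proof.
move=> tI; have s0 := timeS_gt0 tI.
have sq0 : Num.sqrt (S t) != 0 by rewrite gt_eqF // sqrtr_gt0.
have dS : is_derive t (1 : R) S (- shrinking_speed m gk (S t)).
  apply: S_derive; have /andP[-> tT] := timeI tI.
  by rewrite (lt_trans tT) // ltrDl.
rewrite derive1E.
suff [_ ->//] : is_derive t (1 : R) (F p)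
  ((- shrinking_speed m gk (S t) / (2 * S t)) *: F p t).
apply/is_derive_rV => k; rewrite /sphere_flow; under eq_fun do rewrite mxE.
apply: is_derive_eq (is_derive_mul (is_derive_mul (is_derive_sqrtf s0 dS)
  (is_derive_const R0^-1 t (1 : R))) (is_derive_const (p 0 k) t (1 : R))) _.
rewrite !mxE.
have sE : S t = Num.sqrt (S t) ^+ 2 by rewrite sqr_sqrtr // ltW.
have alg (s D x a : R) : s != 0 -> a = s ^+ 2 ->
  (2^-1 * s^-1 * - D * R0^-1 + s * 0) * x + s * R0^-1 * 0 =
  - D / (2 * a) * (s / R0 * x).
  by move=> sn0 ->; field; rewrite ?sn0 ?R0_neq0.
exact: alg.
Qed.

(** The number for which H n is the velocity. That it is the mean curvature follows by solving 2 <H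
    n, F> = -psi(S), the speed formula with zero Hessian. *)
Definition sphere_mean_curvature (t : R) : R :=
  - shrinking_speed m gk (S t) / (2 * S t * outward_scale t).

Lemma sphere_flow_mean_curvature p t : 0 <= t < T -> hypersphere R0 p ->
  mean_curvature f R0 F t p (outward_normal p t) (sphere_mean_curvature t).
Proof.
move=> tI pR; have s0 := timeS_gt0 tI; have p0 := sphere_neq0 R0_gt0 pR.
have [e [kappa ek]] := sphere_flow_principal_frame tI pR.
have H0 : mean_curvature f R0 F t p (outward_normal p t)
    ((\sum_a kappa a) / (m + m).-1%:R).
  by exists kappa; split => //; exists e.
set H := (\sum_a kappa a) / _ in H0; clearbody H.
suff -> : sphere_mean_curvature t = H by [].
have [_ [e' [_ _]]] := mean_curvature_speed gk_derive tangential_gt0 radial_gt0 m_gt0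
  R0_gt0 pR (sphere_flow_neq0 tI pR) (G_derivable tI pR) (DG_derivable tI pR)
  (fun v => @differential_sphere_flow_tangent t p v pR)
  (outward_normal_unit tI pR) H0.
rewrite big1 => [|i _]; last exact: derive2_radius2_sphere_flow.
rewrite mul0r add0r 2!edotZl -/(radius2 _) radius2_sphere_flow //.
rewrite /sphere_mean_curvature => HE.
have o0 : outward_scale t != 0.
  by apply/eqP => o0; have /eqP := outward_scaleE tI; rewrite o0 expr0n /= !mul0r eq_sym oner_eq0.
rewrite -HE; field.
by rewrite o0 gt_eqF.
Qed.

Lemma sphere_flow_is_mcf : mean_curvature_flow f R0 T F.
Proof.
split.
- exact: T_gt0.
- by exists d => //; exact: sphere_flow_smooth.
- by move=> p pR; rewrite /sphere_flow S0 sqrtr_sqr gtr0_norm // divff // scale1r.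
- move=> p t pR tI; split; first exact: sphere_flow_neq0.
  move=> v pv v0; rewrite differential_sphere_flow // scaler_eq0 negb_or v0 andbT.
  by rewrite mulf_neq0 ?invr_eq0 // gt_eqF // sqrtS_gt0.
exists outward_normal, (fun _ => sphere_mean_curvature) => p t pR tI; split.
- exact: outward_normal_unit.
- exact: sphere_flow_mean_curvature.
have s0 := timeS_gt0 tI.
have o0 : outward_scale t != 0.
  by apply/eqP => o0; have /eqP := outward_scaleE tI; rewrite o0 expr0n /= !mul0r eq_sym oner_eq0.
rewrite sphere_flow_velocity // /outward_normal scalerA; congr (_ *: _).
by rewrite /sphere_mean_curvature; field; rewrite o0 gt_eqF.
Qed.

(** S solves the equation beyond T, hence is continuous at T itself. *)
Lemma S_cvg0 : S t @[t --> T^'-] --> (0 : R).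
Proof.
rewrite -ST; apply: cvg_at_left_filter; apply: is_derive_continuous.
by apply: S_derive; rewrite ltrDl d_gt0 andbT (lt_trans _ T_gt0) // oppr_lt0.
Qed.

Let near_time : \forall t \near T^'-, 0 <= t < T.
Proof.
near=> t; apply/andP; split; near: t; last exact: nbhs_left_lt.
exact: nbhs_left_ge.
Unshelve. all: by end_near. Qed.

Lemma sqrtS_cvg0 : Num.sqrt (S t) @[t --> T^'-] --> (0 : R).
Proof.
rewrite -[X in _ --> X](@sqrtr0 R).
by apply: continuous_cvg; [exact: sqrt_continuous | exact: S_cvg0].
Qed.

Lemma sphere_flow_image t : 0 <= t < T ->
  (fun p => F p t) @` hypersphere R0 = hypersphere (Num.sqrt (S t)).
Proof.
move=> tI; have q0 := sqrtS_gt0 tI.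
apply/seteqP; split=> [_ [p pR <-]|q qS]; first exact: enorm_sphere_flow.
exists ((R0 / Num.sqrt (S t)) *: q).
  rewrite /hypersphere /= enormZ (qS : enorm q = _) gtr0_norm ?divr_gt0 //.
  by rewrite divfK // gt_eqF.
rewrite /sphere_flow scalerA -[RHS]scale1r; congr (_ *: _).
by field; rewrite R0_neq0 gt_eqF.
Qed.

Lemma proj_dist_self (w : V) : w != 0 -> proj_dist w w = 0.
Proof.
move=> w0; rewrite /proj_dist hdotE /= edot_Jmul0 expr0n addr0 -/(radius2 w) -expr2.
by rewrite divff ?subrr ?sqrtr0 // sqrf_eq0 radius2_eq0.
Qed.

Lemma zcoordZ (c : R) (w : V) j : zcoord (c *: w) j = real_complex _ c * zcoord w j.
Proof.
apply/eqP; rewrite eq_complex /zcoord /= !mxE !mul0r subr0 addr0.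
by rewrite !eqxx.
Qed.

Lemma sphere_flow_converges : converges_to_exceptional_divisor R0 T F.
Proof.
split.
  exists (fun t => Num.sqrt (S t)); split; last exact: sqrtS_cvg0.
  by move=> t tI; rewrite sqrtS_gt0 // sphere_flow_image.
move=> eps eps0; near=> t.
have tI : 0 <= t < T by near: t.
have q0 := sqrtS_gt0 tI.
have qe : Num.sqrt (S t) < eps.
  by near: t; apply: (cvgr_lt (0 : R)); [exact: sqrtS_cvg0 | exact: eps0].
rewrite /= sphere_flow_image //; split.
  (* In both directions the line [w] is kept and only z moves, so the distance is the radius of the
     sphere. *)
  move=> [z w] [[/= w0 zw] zS]; exists (0, w).
    split; last by [].
    split=> //= i j; rewrite /zcoord !mxE.
    by rewrite -[Complex 0 0]/(0 : complex R) !mul0r subr0.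
  by rewrite /Bl0_dist /= subr0 (zS : enorm z = _) proj_dist_self // addr0.
move=> [z w] [[/= w0 zw] z0]; rewrite /= in z0.
exists ((Num.sqrt (S t) / enorm w) *: w, w).
  split; last first.
    rewrite /= /hypersphere /= enormZ gtr0_norm; last by rewrite divr_gt0 // enorm_gt0.
    by rewrite divfK // enorm_eq0.
  by split=> //= i j; rewrite !zcoordZ; ring.
rewrite /Bl0_dist /= z0 subr0 proj_dist_self // addr0 enormZ gtr0_norm.
  by rewrite divfK // enorm_eq0.
by rewrite divr_gt0 // enorm_gt0.
Unshelve. all: by end_near. Qed.

Variables c k l L : R.
Hypothesis k_gt0 : 0 < k.
Hypothesis l_gt0 : 0 < l.
Hypothesis S_lt : forall t, - d < t < T + d -> `|S t| < c.
Hypothesis profile : forall x, `|x| < c ->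
  k < shrinking_speed m gk x /\ l < scaled_sff_norm2 m gk x < L.

Let S_lt' t : 0 <= t < T -> `|S t| < c.
Proof.
by move=> /timeI/andP[t1 t2]; apply: S_lt; rewrite t1 (lt_trans t2) // ltrDl.
Qed.

Lemma sphere_flow_sff_norm2 t p A2 : 0 <= t < T -> hypersphere R0 p ->
  sff_norm2 f R0 F t p A2 -> A2 = scaled_sff_norm2 m gk (S t) / S t.
Proof.
move=> tI pR; rewrite -(radius2_sphere_flow tI pR).
apply: sff_norm2_value => //.
- exact: sphere_flow_neq0.
- exact: G_derivable.
- exact: DG_derivable.
- by move=> v; exact: differential_sphere_flow_tangent.
- by move=> v w; exact: derive2_radius2_sphere_flow tI (sphere_neq0 R0_gt0 pR).
Qed.

Lemma sphere_flow_singular : singular_time f R0 T F.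
Proof.
move=> K.
have [p pR] := hypersphere_nonempty m_gt0 R0_gt0.
have K1 : 0 < `|K| + 1 by rewrite ltr_wpDl.
near=> t; have tI : 0 <= t < T by near: t.
have s0 := timeS_gt0 tI.
(* Then l / S exceeds |K| + 1; the absolute value and the 1 make the threshold positive for every
   K. *)
have St : S t < l / (`|K| + 1).
  by near: t; apply: (cvgr_lt (0 : R)); [exact: S_cvg0 | exact: divr_gt0].
have [e [kappa [eo _]]] := sphere_flow_principal_frame tI pR.
exists p; eexists; split; first exact: pR.
  by exists (outward_normal p t), e; split=> //; exact: outward_normal_unit.
rewrite (sphere_flow_sff_norm2 tI pR (A2 := \sum_a \sum_b _)); last first.
  by exists (outward_normal p t), e; split=> //; exact: outward_normal_unit.
have [_ /andP[ln _]] := profile (S_lt' tI).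
apply: (@le_trans _ _ (l / S t)); last by rewrite ler_pM2r ?invr_gt0 // ltW.
rewrite ler_pdivlMr // (le_trans (ler_wpM2r (ltW s0) (ler_norm K))) //.
move: St; rewrite ltr_pdivlMr // => St; apply: le_trans (ltW St).
by rewrite mulrC ler_pM2l // lerDl.
Unshelve. all: by end_near. Qed.

(** The mean value theorem on [t, T] with S(T) = 0 and psi > k. *)
Lemma S_lower_bound t : 0 <= t < T -> k * (T - t) <= S t.
Proof.
move=> /andP[t0 tT].
have sub x : t <= x <= T -> - d < x < T + d.
  move=> /andP[tx xT]; apply/andP; split.
    by apply: lt_le_trans tx; apply: lt_le_trans t0; rewrite oppr_lt0.
  by apply: le_lt_trans xT _; rewrite ltrDl.
have [||x] := @MVT R S (fun x => - shrinking_speed m gk (S x)) t T tT.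
- move=> x; rewrite in_itv /= => /andP[tx xT]; apply: S_derive; apply: sub.
  by rewrite !ltW.
- apply: continuous_in_subspaceT => x; rewrite inE /= in_itv /= => /sub xI.
  exact: is_derive_continuous (S_derive xI).
rewrite in_itv /= => /andP[tx xT]; rewrite ST sub0r mulNr => /oppr_inj ->.
rewrite ler_pM2r ?subr_gt0 //; have [] := @profile (S x).
  by apply: S_lt; apply: sub; rewrite !ltW.
by move=> /ltW.
Qed.

Lemma sphere_flow_type_I : type_I f R0 T F.
Proof.
have L0 : 0 < L.
  have tI : 0 <= (0 : R) < T by rewrite lexx.
  by have [_ /andP[a b]] := profile (S_lt' tI); exact: lt_trans l_gt0 (lt_trans a b).
(* The estimate is |A|^2 < L/S <= (L/k) / (T - t); adding 2 guarantees a constant above 1. *)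
exists (L / k + 2).
  by rewrite ltr_wpDl ?ltr1n // ltW // divr_gt0.
move=> t p A2 tI pR /(sphere_flow_sff_norm2 tI pR) ->.
have s0 := timeS_gt0 tI; have /andP[_ tT] := tI.
have [_ /andP[_ nL]] := profile (S_lt' tI).
apply: (@le_trans _ _ (L / S t)); first by rewrite ler_pM2r ?invr_gt0 // ltW.
have kT : 0 < k * (T - t) by rewrite mulr_gt0 // subr_gt0.
apply: (@le_trans _ _ (L / (k * (T - t)))).
  by rewrite ler_pM2l // lef_pV2 ?posrE // S_lower_bound.
by rewrite invfM mulrA ler_pM2r ?invr_gt0 ?subr_gt0 // lerDl.
Qed.

End ShrinkingSphere.

(** * Maximum principle and uniqueness *)

Section MaximumPrinciple.
Context {R : realType}.

(** If A were positive, k = h' would be positive just to the right of 0 and h would increase there,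
    against the maximum. *)
Lemma second_derivative_test (h k : R -> R) (A : R) :
  (\forall s \near (0 : R), h s <= h 0) ->
  (\forall s \near (0 : R), is_derive s (1 : R) h (k s)) ->
  is_derive (0 : R) (1 : R) k A -> k 0 = 0 /\ A <= 0.
Proof.
move=> hmax hd kd.
have /nbhs_ballP[e /= e0 eP] : \forall s \near (0 : R), h s <= h 0 /\ is_derive s (1 : R) h (k s).
  by near=> s; split; near: s.
have inb s : - e < s < e -> h s <= h 0 /\ is_derive s (1 : R) h (k s).
  by move=> se; apply: eP; rewrite /ball /= sub0r normrN ltr_norml.
have k0 : k 0 = 0.
  have [] : is_derive (0 : R) (1 : R) h 0.
    apply: (@derive1_at_max _ h (- e) e 0).
    - by lra.
    - by move=> s; rewrite in_itv /= => /inb[_ []].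
    - by rewrite in_itv /=; apply/andP; split; lra.
    - by move=> s; rewrite in_itv /= => /inb[].
  have [_ [_ <-]] : h 0 <= h 0 /\ is_derive (0 : R) (1 : R) h (k 0).
    by apply: inb; apply/andP; split; lra.
  by [].
split=> //; rewrite leNgt; apply/negP => A0.
have [kder kA] := kd.
have : \forall s \near (0 : R)^', 0 < s^-1 * k s.
  have : (fun s : R => s^-1 *: (k (s *: 1 + 0) - k 0)) @ (0 : R)^' --> A.
    by rewrite -kA; exact: kder.
  move=> /(cvgr_gt A)/(_ _ A0); apply: filterS => s.
  by rewrite k0 subr0 addr0 [s *: 1]mulr1.
rewrite near_withinE => /nbhs_ballP[e1 /= e10 e1P].
pose r := Num.min e e1 / 2.
have m0 : 0 < Num.min e e1 by rewrite lt_min e0 e10.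
have r0 : 0 < r by rewrite divr_gt0.
have re : r < e by apply: (@lt_le_trans _ _ (Num.min e e1)); [rewrite /r; lra | rewrite ge_min lexx].
have re1 : r < e1.
  by apply: (@lt_le_trans _ _ (Num.min e e1)); [rewrite /r; lra | rewrite ge_min lexx orbT].
have kpos s : 0 < s -> s < e1 -> 0 < k s.
  move=> s0 se1; have : 0 < s^-1 * k s.
    by apply: e1P; rewrite ?gt_eqF // /ball /= sub0r normrN gtr0_norm.
  by rewrite pmulr_rgt0 // invr_gt0.
have hr : h r <= h 0 by have [|] := inb r; first by apply/andP; split; lra.
have : h 0 < h r.
  apply: (@gtr0_derive1_incr _ h 0 r).
  - move=> s; rewrite in_itv /= => /andP[s1 s2].
    by have [|_ []] := inb s; first by apply/andP; split; lra.
  - move=> s; rewrite in_itv /= => /andP[s1 s2]; rewrite derive1E.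
    have [|_ [_ ->]] := inb s; first by apply/andP; split; lra.
    by apply: kpos => //; lra.
  - apply: continuous_in_subspaceT => s; rewrite inE /= in_itv /= => /andP[s1 s2].
    have [|_ ] := inb s; first by apply/andP; split; lra.
    exact: is_derive_continuous.
  - exact: lexx.
  - exact: r0.
  - exact: lexx.
by rewrite ltNge hr.
Unshelve. all: by end_near. Qed.

Lemma near_along (E : normedModType R) (x v : E) (P : set E) :
  (\forall y \near x, P y) -> \forall s \near (0 : R), P (s *: v + x).
Proof.
have c : (fun s : R => s *: v + x) @ (0 : R) --> x.
  rewrite -[X in _ --> X]add0r -[X in _ --> X + _](scale0r v).
  by apply: cvgD; [exact: scalel_continuous | exact: cvg_cst].
by move=> /c.
Qed.

Lemma is_derive_along_at (E : normedModType R) (u : E -> R) (x v : E) (s d : R) :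
  is_derive (s *: v + x) v u d -> is_derive s (1 : R) (fun r : R => u (r *: v + x)) d.
Proof.
move=> /is_derive_along du.
have shift : is_derive s (1 : R) (fun r : R => r - s) 1.
  by apply: is_derive_eq (is_deriveB (is_derive_id s 1) (is_derive_cst s s 1)) _;
    rewrite subr0.
have du' : is_derive (s - s) (1 : R) (fun r : R => u (r *: v + (s *: v + x))) d.
  by rewrite subrr.
have := @is_derive1_comp _ _ _ s _ _ du' shift; rewrite mulr1.
rewrite (_ : _ \o _ = (fun r : R => u (r *: v + x))) //.
by apply/funext => r /=; rewrite addrA -scalerDl subrK.
Qed.

Lemma directional_second_derivative_test (E : normedModType R) (u : E -> R)
    (eps : R) (x v : E) :
  (\forall y \near x, eps * u y <= eps * u x) ->
  (\forall y \near x, derivable u y v) -> derivable ('D_v u) x v ->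
  eps * 'D_v u x = 0 /\ eps * 'D_v ('D_v u) x <= 0.
Proof.
move=> umax ud udd.
have := @second_derivative_test (fun s => eps * u (s *: v + x))
  (fun s => eps * 'D_v u (s *: v + x)) (eps * 'D_v ('D_v u) x).
rewrite scale0r add0r; apply.
- exact: (near_along v umax).
- apply: filterS (near_along v ud) => s /derivableP/is_derive_along_at us.
  apply: is_derive_eq (is_derive_mul (is_derive_const eps s (1 : R)) us) _.
  by rewrite mul0r add0r.
have udd' : is_derive (0 *: v + x) v ('D_v u) ('D_v ('D_v u) x).
  by rewrite scale0r add0r; exact: derivableP.
apply: is_derive_eq
  (is_derive_mul (is_derive_const eps (0 : R) (1 : R)) (is_derive_along_at udd')) _.
by rewrite mul0r add0r.
Qed.

(** The difference quotients of h at t from the left are positive. *)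
Lemma derive_ge0_at_first_zero (h : R -> R) (t a b : R) :
  is_derive t (1 : R) h a -> b < t -> h t = 0 ->
  (forall s, b < s < t -> h s < 0) -> 0 <= a.
Proof.
move=> [hd ha] bt ht hneg; rewrite leNgt; apply/negP => a0.
have : \forall s \near (0 : R)^', s^-1 * h (s + t) < 0.
  have : (fun s : R => s^-1 *: (h (s *: 1 + t) - h t)) @ (0 : R)^' --> a.
    by rewrite -ha; exact: hd.
  move=> /(cvgr_lt a)/(_ _ a0); apply: filterS => s.
  by rewrite ht subr0 [s *: 1]mulr1.
rewrite near_withinE => /nbhs_ballP[e /= e0 eP].
pose r := Num.min e (t - b) / 2.
have m0 : 0 < Num.min e (t - b) by rewrite lt_min e0 subr_gt0.
have r0 : 0 < r by rewrite divr_gt0.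
have rm : r < Num.min e (t - b) by rewrite /r; lra.
have [re rb] : r < e /\ r < t - b by move: rm; rewrite lt_min => /andP[].
have : (- r)^-1 * h (- r + t) < 0.
  by apply: eP; rewrite ?oppr_eq0 ?gt_eqF // /ball /= sub0r opprK gtr0_norm.
rewrite nmulr_rlt0 ?invr_lt0 ?oppr_lt0 //.
by rewrite ltNge ltW // hneg //; apply/andP; split; lra.
Qed.

End MaximumPrinciple.

Lemma hypersphere_compact (R : realType) (m : nat) (r : R) :
  compact (hypersphere r : set 'rV[R]_(m + m)).
Proof.
apply: bounded_closed_compact.
  exists r; split; first exact: num_real.
  move=> M rM z zr /=; rewrite /Num.Def.normr /= mx_normrE.
  apply: bigmax_le => [|[i k] _].
    by apply: le_trans (ltW rM); rewrite -(zr : enorm z = r) enorm_ge0.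
  apply: le_trans (ltW rM); rewrite -(zr : enorm z = r) ord1 -sqrtr_sqr /=.
  rewrite /enorm ler_sqrt ?radius2_ge0 // /radius2 /edot (bigD1 k) //= expr2.
  by rewrite lerDl sumr_ge0 // => j _; rewrite -expr2 sqr_ge0.
have -> : hypersphere r = @enorm R m @^-1` [set r] by [].
apply: closed_comp; first by move=> x _; exact: enorm_continuous.
exact: closed_eq.
Qed.

Section Uniqueness.
Context {R : realType} {m : nat}.
Local Notation V := 'rV[R]_(m + m).
Variables (gk : nat -> R -> R).
Hypothesis gk_derive : forall n (s : R), 0 <= s ->
  \forall x \near s, is_derive x (1 : R) (gk n) (gk n.+1 x).
Hypothesis tangential_gt0 : forall x : R, 0 < x -> 0 < tangential gk x.
Hypothesis radial_gt0 : forall x : R, 0 < x -> 0 < radial gk x.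
Hypothesis m_gt0 : (0 < m)%N.
Local Notation f := (fun S : R => ln S + gk 0 S).
Variables (R0 T' : R) (F : V -> R -> V).
Hypothesis R0_gt0 : 0 < R0.
Hypothesis F_mcf : mean_curvature_flow f R0 T' F.
Local Notation psi := (shrinking_speed m gk).
Local Notation w := (fun p t => radius2 (F p t)).
Local Notation u t := (fun y => radius2 (ray_ext R0 F t y)).

Let T'_gt0 : 0 < T'. Proof. by case: F_mcf. Qed.

Let F_smooth : exists2 delta, 0 < delta &
  smooth_on [set xt : V * R | xt.1 != 0 /\ - delta < xt.2 < T']
    (fun xt : V * R => ray_ext R0 F xt.2 xt.1).
Proof. by case: F_mcf. Qed.

Let F0 p : hypersphere R0 p -> F p 0 = p.
Proof. by case: F_mcf => _ _ /(_ p). Qed.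

Let F_neq0 p t : hypersphere R0 p -> 0 <= t < T' -> F p t != 0.
Proof. by case: F_mcf => _ _ _ H _ pR tI; have [] := H p t pR tI. Qed.

Let F_equation p t : hypersphere R0 p -> 0 <= t < T' -> exists n H,
  [/\ unit_normal f R0 F t p n, mean_curvature f R0 F t p n H &
      (F p)^`()%classic t = H *: n].
Proof.
case: F_mcf => _ _ _ _ [n [H nH]] pR tI.
by exists (n p t), (H p t); exact: nH.
Qed.

Let timeI (delta t : R) : 0 < delta -> 0 <= t < T' -> - delta < t < T'.
Proof.
by move=> d0 /andP[t0 ->]; rewrite andbT (lt_le_trans _ t0) // oppr_lt0.
Qed.

Let near_neq0 (p : V) : hypersphere R0 p -> \forall y \near p, y != 0.
Proof.
move=> pR; have p0 : 0 < enorm p by rewrite enorm_gt0 (sphere_neq0 R0_gt0 pR).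
apply: filterS (continuous_near_gt (@enorm_continuous R m p) p0) => y.
by rewrite enorm_gt0.
Qed.

Let G_derivable p t : hypersphere R0 p -> 0 <= t < T' ->
  forall v, \forall y \near p, derivable (ray_ext R0 F t) y v.
Proof.
move=> pR tI v; have [delta d0 Fs] := F_smooth.
apply: filterS (near_neq0 pR) => y y0.
exact: (ray_ext_derivable Fs (timeI d0 tI) y0).
Qed.

Let DG_derivable p t : hypersphere R0 p -> 0 <= t < T' ->
  forall v v', derivable ('D_v' (ray_ext R0 F t)) p v.
Proof.
move=> pR tI v v'; have [delta d0 Fs] := F_smooth.
exact: (derive_ray_ext_derivable Fs (timeI d0 tI) (sphere_neq0 R0_gt0 pR)).
Qed.

Lemma flow_time_derive p t : hypersphere R0 p -> 0 <= t < T' ->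
  is_derive t (1 : R) (F p) ((F p)^`()%classic t).
Proof.
move=> pR tI; have [delta d0 Fs] := F_smooth.
by rewrite derive1E; apply: derivableP; exact: (flow_derivable Fs R0_gt0 pR (timeI d0 tI)).
Qed.

Let rescale (y : V) : y != 0 -> hypersphere R0 ((R0 / enorm y) *: y).
Proof.
move=> y0; rewrite /hypersphere /= enormZ gtr0_norm ?divfK ?enorm_eq0 //.
by rewrite divr_gt0 // enorm_gt0.
Qed.

(** For eps = 1 a maximum point of |F(., t)|^2 on the sphere, for eps = -1 a minimum point. *)
Definition extremal (eps t : R) (p : V) :=
  forall q, hypersphere R0 q -> eps * w q t <= eps * w p t.

(* At an extremal point the hypersurface touches a sphere centred at 0, and the
   second derivative test compares their mean curvatures. *)
Lemma extremal_derivatives eps t p v : hypersphere R0 p -> 0 <= t < T' ->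
  extremal eps t p ->
  eps * 'D_v (u t) p = 0 /\ eps * 'D_v ('D_v (u t)) p <= 0.
Proof.
move=> pR tI ext; apply: directional_second_derivative_test.
- apply: filterS (near_neq0 pR) => y y0.
  rewrite (ray_ext_on_sphere F R0_gt0 t pR); exact: ext (rescale y0).
- apply: filterS (derive_radius2_ray_ext (G_derivable pR tI) v) => y.
  by case.
- by have [] := derive2_radius2_ray_ext R0_gt0 pR (G_derivable pR tI)
    (DG_derivable pR tI) v v.
Qed.

Lemma extremal_speed eps t p : hypersphere R0 p -> 0 <= t < T' -> eps != 0 ->
  extremal eps t p ->
  exists s dw, [/\ (F p)^`()%classic t = s *: F p t, dw = 2 * (s * w p t),
    is_derive t (1 : R) (w p) dw & eps * dw <= - eps * psi (w p t)].
Proof.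
move=> pR tI eps0 ext; have [n [H [nn nH FH]]] := F_equation pR tI.
(* The first-order condition on |F|^2 is exactly the orthogonality required by the radial curvature
   formulas. *)
have dF_tangent v : tangent p v -> edot (differential R0 F t p v) (F p t) = 0.
  move=> _; have [/eqP + _] := extremal_derivatives v pR tI ext.
  rewrite mulf_eq0 (negbTE eps0) /=.
  have [_ ->] := nbhs_singleton (derive_radius2_ray_ext (G_derivable pR tI) v).
  rewrite (ray_ext_on_sphere F R0_gt0 t pR) mulf_eq0 pnatr_eq0 /=.
  by move=> /eqP.
have [s [e [nE eT spd]]] := mean_curvature_speed gk_derive tangential_gt0 radial_gt0
  m_gt0 R0_gt0 pR (F_neq0 pR tI) (G_derivable pR tI) (DG_derivable pR tI)
  dF_tangent nn nH.
exists (H * s), (2 * (H * s * w p t)).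
have FE : (F p)^`()%classic t = (H * s) *: F p t by rewrite FH nE scalerA.
split=> //.
  apply: is_derive_eq (is_derive_radius2 (flow_time_derive pR tI)) _.
  by rewrite FE edotZl.
have -> : 2 * (H * s * w p t) = 2 * edot (H *: n) (F p t).
  by rewrite nE scalerA edotZl.
rewrite spd.
have : eps * (\sum_i 'D_(e i) ('D_(e i) (u t)) p) <= 0.
  rewrite mulr_sumr; apply: sumr_le0 => i _.
  by have [] := extremal_derivatives (e i) pR tI ext.
move: (\sum_i _) (psi _) => D P epsD.
rewrite mulrBr mulNr lerBlDr addNr mulrA pmulr_lle0 // invr_gt0 ltr0n.
by case: (m) m_gt0 => // k _; rewrite addnS.
Qed.

Lemma radius2_flow_continuous p t : hypersphere R0 p -> 0 <= t < T' ->
  {for (p, t), continuous (fun xt : V * R => u xt.2 xt.1)}.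
Proof.
move=> pR tI; have [delta d0 Fs] := F_smooth.
have c := ray_ext_continuous Fs (timeI d0 tI) (sphere_neq0 R0_gt0 pR).
exact: (continuous_comp c (@radius2_continuous R m _)).
Qed.

(* For eps = 1 (resp. -1), beta is a strict upper (resp. lower) barrier for
   |F|^2: consider the first time at which it is touched. *)
Lemma barrier eps (t1 : R) (beta dbeta : R -> R) :
  eps != 0 -> t1 < T' ->
  (forall t, 0 <= t <= t1 -> is_derive t (1 : R) beta (dbeta t)) ->
  eps * (R0 ^+ 2 - beta 0) < 0 ->
  (forall t, 0 <= t <= t1 -> - eps * psi (beta t) < eps * dbeta t) ->
  forall p t, hypersphere R0 p -> 0 <= t <= t1 -> eps * (w p t - beta t) < 0.
Proof.
move=> eps0 t1T dbeta_ beta0 ineq p0 t0 p0R t0I; rewrite ltNge; apply/negP => bad0.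
have tI t : 0 <= t <= t1 -> 0 <= t < T'.
  by move=> /andP[-> /le_lt_trans]; apply.
pose K : set (V * R) := hypersphere R0 `*` `[0, t1].
pose phi (xt : V * R) := eps * (u xt.2 xt.1 - beta xt.2).
(* The compact set of points where the barrier is reached or crossed; its earliest time is the first
   contact. *)
pose A : set (V * R) := K `&` [set xt | 0 <= phi xt].
have phiE p t : hypersphere R0 p -> phi (p, t) = eps * (w p t - beta t).
  by move=> pR; rewrite /phi /= (ray_ext_on_sphere F R0_gt0 t pR).
have KI p t : K (p, t) -> hypersphere R0 p /\ 0 <= t <= t1.
  by move=> [pR]; rewrite /= in_itv /=.
have phic xt : K xt -> {for xt, continuous phi}.
  case: xt => p t /KI[pR t01].
  have c1 := radius2_flow_continuous pR (tI t t01).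
  have c2 : {for (p, t), continuous (fun xt : V * R => beta xt.2)}.
    have c3 : {for (p, t), continuous (fun xt : V * R => xt.2)} by exact: cvg_snd.
    exact: (continuous_comp c3 (is_derive_continuous (dbeta_ t t01))).
  apply: continuousM; first exact: cst_continuous.
  by apply: continuousB; [exact: c1 | exact: c2].
have Kc : compact K.
  by apply: compact_setX; [exact: hypersphere_compact | exact: segment_compact].
have Ac : compact A.
  apply: (subclosed_compact _ Kc); last by move=> xt [].
  move=> xt clA; have Kxt : K xt.
    have clK : closed K by apply: compact_closed Kc; exact: norm_hausdorff.
    by apply: clK; apply: closureS clA => ? [].
  split=> //=; rewrite leNgt; apply/negP => neg.
  have := continuous_near_lt (phic _ Kxt) neg.
  by move=> /clA[yt [[_ /= le0] lt0]]; rewrite ltNge le0 in lt0.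
have A0 : A !=set0.
  exists (p0, t0); split; last by rewrite /= phiE.
  by split => //=; rewrite in_itv.
have sc : {within A, continuous (fun xt : V * R => xt.2)}.
  by apply: continuous_subspaceT => xt; exact: cvg_snd.
have [[p t]] := compact_EVT_min A0 Ac sc.
rewrite inE => -[/KI[pR t01] /= phi0] tmin.
have early q s : hypersphere R0 q -> 0 <= s < t -> eps * (w q s - beta s) < 0.
  move=> qR /andP[s0 st]; rewrite ltNge; apply/negP => bad.
  have : (q, s) \in A.
    rewrite inE; split; last by rewrite /= phiE.
    split=> //=; rewrite in_itv /= s0 (le_trans (ltW st)) //.
    by case/andP: t01.
  by move=> /tmin /=; rewrite leNgt st.
have t_gt0 : 0 < t.
  rewrite lt_neqAle; case/andP: (t01) => -> _; rewrite andbT.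
  apply/eqP => t00; move: phi0; rewrite -t00 phiE // F0 // -sqr_enorm.
  by rewrite (pR : enorm p = R0) leNgt beta0.
(* A strict crossing at time t would, by continuity, already occur slightly earlier. *)
have late q : hypersphere R0 q -> eps * (w q t - beta t) <= 0.
  move=> qR; rewrite leNgt; apply/negP => pos.
  have [_ qt] : True /\ K (q, t) by split => //; split=> //=; rewrite in_itv.
  rewrite -phiE // in pos.
  have c : {for t, continuous (fun s => phi (q, s))}.
    have c1 : {for t, continuous (fun s : R => (q, s))}.
      move=> P [[A1 A2] /= [A1q A2t] AP]; apply: filterS A2t => s A2s.
      by apply: AP; split=> //=; exact: nbhs_singleton A1q.
    exact: (continuous_comp c1 (phic _ qt)).
  have := continuous_near_gt c pos => /nbhs_ballP[e /= e0 eP].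
  pose r := Num.min e t / 2.
  have m0 : 0 < Num.min e t by rewrite lt_min e0.
  have rm : r < Num.min e t by rewrite /r; lra.
  have r0 : 0 < r by rewrite divr_gt0.
  have [re rt] : r < e /\ r < t by move: rm; rewrite lt_min => /andP[].
  have : 0 < phi (q, t - r).
    by apply: eP; rewrite /ball /= opprB addrCA subrr addr0 gtr0_norm.
  rewrite phiE // ltNge ltW // early //.
  by apply/andP; split; lra.
have touch : eps * (w p t - beta t) = 0.
  by apply/eqP; rewrite eq_le late //= -phiE.
have wbeta : w p t = beta t.
  by move/eqP: touch; rewrite mulf_eq0 (negbTE eps0) subr_eq0 => /eqP.
(* At first contact p attains the value beta(t), which bounds all the others. *)
have ext : extremal eps t p.
  by move=> q qR; have := late q qR; rewrite wbeta mulrBr subr_le0.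
have [s [dw [_ _ dwE dw_le]]] := extremal_speed pR (tI t t01) eps0 ext.
have dphi : is_derive t (1 : R) (fun s => eps * (w p s - beta s)) (eps * (dw - dbeta t)).
  apply: is_derive_eq (is_derive_mul (is_derive_const eps t (1 : R))
    (is_deriveB dwE (dbeta_ t t01))) _.
  by rewrite mul0r add0r.
have : 0 <= eps * (dw - dbeta t).
  apply: derive_ge0_at_first_zero dphi t_gt0 touch _ => r /andP[r0 rt].
  by apply: early => //; rewrite ltW.
have := ineq t t01; rewrite -wbeta mulrBr.
by move: dw_le; lra.
Qed.

End Uniqueness.

(** * Comparison with the scalar solution and uniqueness of the flow *)

Section Comparison.
Context {R : realType} {m : nat}.
Local Notation V := 'rV[R]_(m + m).
Variables (gk : nat -> R -> R).
Hypothesis gk_derive : forall n (s : R), 0 <= s ->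
  \forall x \near s, is_derive x (1 : R) (gk n) (gk n.+1 x).
Hypothesis tangential_gt0 : forall x : R, 0 < x -> 0 < tangential gk x.
Hypothesis radial_gt0 : forall x : R, 0 < x -> 0 < radial gk x.
Hypothesis m_gt0 : (0 < m)%N.
Local Notation f := (fun S : R => ln S + gk 0 S).
Local Notation psi := (shrinking_speed m gk).
Variables (R0 T d : R) (S : R -> R).
Hypothesis R0_gt0 : 0 < R0.
Hypothesis T_gt0 : 0 < T.
Hypothesis d_gt0 : 0 < d.
Hypothesis S0 : S 0 = R0 ^+ 2.
Hypothesis ST : S T = 0.
Hypothesis S_derive : forall t : R, - d < t < T + d ->
  is_derive t (1 : R) S (- psi (S t)).
Hypothesis S_gt0 : forall t : R, - d < t < T -> 0 < S t.
Hypothesis psi_gt0 : forall t : R, - d < t < T + d -> 0 < psi (S t).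
Variables (T' : R) (F : V -> R -> V).
Hypothesis F_mcf : mean_curvature_flow f R0 T' F.
Local Notation w := (fun p t => radius2 (F p t)).

Lemma S_decreasing (x y : R) : - d < x -> x < y -> y < T + d -> S y < S x.
Proof.
move=> dx xy yT.
have sub z : x <= z <= y -> - d < z < T + d.
  by move=> /andP[? ?]; apply/andP; split; lra.
have [||z] := @MVT R S (fun z => - psi (S z)) x y xy.
- move=> z; rewrite in_itv /= => /andP[xz zy]; apply: S_derive; apply: sub.
  by rewrite !ltW.
- apply: continuous_in_subspaceT => z; rewrite inE /= in_itv /= => /sub zI.
  exact: is_derive_continuous (S_derive zI).
rewrite in_itv /= => /andP[xz zy] SE.
have := psi_gt0 (sub z _); rewrite !ltW // => /(_ isT) psi0.
by rewrite -subr_lt0 SE mulNr oppr_lt0 mulr_gt0 // subr_gt0.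
Qed.

(* The barriers are the time-changed solutions S((1 + eta) t + eta). *)
Lemma radius_comparison eps p t1 : eps = 1 \/ eps = -1 ->
  hypersphere R0 p -> 0 <= t1 < T' -> t1 < T -> eps * (w p t1 - S t1) <= 0.
Proof.
move=> eps1 pR /andP[t10 t1T'] t1T; rewrite leNgt; apply/negP => pos.
have eps2 : eps * eps = 1 by case: eps1 => ->; rewrite ?mulr1 ?mulrNN ?mulr1.
have eps0 : eps != 0 by case: eps1 => ->; rewrite ?oppr_eq0 oner_eq0.
pose tau (eta t : R) := (1 + eta) * t + eta.
have tau0 : tau 0 t1 = t1 by rewrite /tau !addr0 mul1r.
have tauc : {for 0, continuous (fun eta => tau eta t1)}.
  apply: continuousD; last exact: cvg_id.
  apply: continuousM; last exact: cst_continuous.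
  by apply: continuousD; [exact: cst_continuous | exact: cvg_id].
have t1I : - d < t1 < T + d.
  by apply/andP; split; [apply: lt_le_trans t10; rewrite oppr_lt0 | rewrite (lt_trans t1T) // ltrDl].
(* A strict violation at time t1 persists for the barriers with small eta, which is what they will
   contradict. *)
have near1 : \forall eta \near (0 : R), 0 < eps * (w p t1 - S (tau eta t1)).
  apply: (continuous_near_gt (h := fun eta => eps * (w p t1 - S (tau eta t1)))).
    apply: continuousM; first exact: cst_continuous.
    apply: continuousB; first exact: cst_continuous.
    apply: (continuous_comp tauc); rewrite tau0.
    exact: is_derive_continuous (S_derive t1I).
  by rewrite tau0.
have near2 : \forall eta \near (0 : R), tau eta t1 < T.
  by apply: (continuous_near_lt (h := fun eta => tau eta t1)); rewrite ?tau0.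
have : \forall eta \near (0 : R), 0 < eps * (w p t1 - S (tau eta t1)) /\ tau eta t1 < T.
  by near=> eta; split; near: eta.
move=> /nbhs_ballP[e /= e0 eP].
pose mn := Num.min (Num.min e d) (Num.min 1 T).
have mn0 : 0 < mn by rewrite !lt_min e0 d_gt0 ltr01 T_gt0.
pose h := mn / 2.
have h0 : 0 < h by rewrite divr_gt0.
have : h < mn by rewrite /h; lra.
rewrite !lt_min => /andP[/andP[he hd] /andP[h1 hT]].
(* For eps = 1 the solution starts earlier and runs slower, so it lies above; for eps = -1 it starts
   later and runs faster. The barrier inequality holds with the excess h psi > 0. *)
pose eta := - eps * h.
have eta_abs : - h <= eta <= h.
  by rewrite /eta; case: eps1 => ->; apply/andP; split; lra.
have [pos1 tauT] : 0 < eps * (w p t1 - S (tau eta t1)) /\ tau eta t1 < T.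
  apply: eP; rewrite /ball /= sub0r normrN; apply: le_lt_trans he.
  by rewrite ler_norml.
have eta1 : 0 < 1 + eta by case/andP: eta_abs => ? ?; lra.
have tauI t : 0 <= t <= t1 -> - d < tau eta t < T + d.
  move=> /andP[t_ge0 tt1]; apply/andP; split.
    have : 0 <= (1 + eta) * t by rewrite mulr_ge0 // ltW.
    by rewrite /tau; case/andP: eta_abs => ? ?; lra.
  have : (1 + eta) * t <= (1 + eta) * t1 by rewrite ler_pM2l.
  by move: tauT; rewrite /tau; lra.
have bar : eps * (w p t1 - S (tau eta t1)) < 0.
  apply: (barrier gk_derive tangential_gt0 radial_gt0 m_gt0 R0_gt0 F_mcf eps0
    t1T' (beta := fun t => S (tau eta t))
    (dbeta := fun t => - psi (S (tau eta t)) * (1 + eta))) => //.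
  - move=> t tI.
    have taud : is_derive t (1 : R) (tau eta) (1 + eta).
      apply: is_derive_eq (is_derive_add (is_derive_mul
        (is_derive_const (1 + eta) t (1 : R)) (is_derive_ident t (1 : R)))
        (is_derive_const eta t (1 : R))) _.
      by rewrite mul0r add0r mulr1 addr0.
    exact: is_derive_chain taud (S_derive (tauI t tI)).
  - rewrite /tau mulr0 add0r -S0 /eta.
    case: eps1 => ->.
      rewrite mul1r mulN1r subr_lt0; apply: S_decreasing; lra.
    rewrite opprK mul1r mulN1r oppr_lt0 subr_gt0; apply: S_decreasing; lra.
  - move=> t tI; have psi0 := psi_gt0 (tauI t tI).
    rewrite -subr_gt0.
    have -> : eps * (- psi (S (tau eta t)) * (1 + eta)) - - eps * psi (S (tau eta t)) =
        (eps * eps) * (h * psi (S (tau eta t))).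
      by move: (psi _) => P; rewrite /eta; ring.
    by rewrite eps2 mul1r mulr_gt0.
  - by rewrite t10 lexx.
by move: (lt_trans pos1 bar); rewrite ltxx.
Unshelve. all: by end_near. Qed.

Lemma radius_unique p t : hypersphere R0 p -> 0 <= t < T' -> t < T -> w p t = S t.
Proof.
move=> pR tI tT.
have le1 := @radius_comparison 1 p t (or_introl erefl) pR tI tT.
have le2 := @radius_comparison (-1) p t (or_intror erefl) pR tI tT.
rewrite mul1r subr_le0 in le1; rewrite mulN1r oppr_le0 subr_ge0 in le2.
by apply/eqP; rewrite eq_le le1 le2.
Qed.

Lemma flow_unique p t : hypersphere R0 p -> 0 <= t < T' -> t < T ->
  F p t = sphere_flow R0 S p t.
Proof.
move=> pR /andP[t0 tT'] tT.
have F0 : F p 0 = p by case: F_mcf => _ _ /(_ p pR).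
have sI s : 0 <= s <= t -> 0 <= s < T' /\ s < T.
  by move=> /andP[-> st]; split; rewrite ?(le_lt_trans st).
have sI' s : 0 <= s <= t -> - d < s < T.
  move=> st; have [/andP[s0 _] ->] := sI s st; rewrite andbT.
  by apply: lt_le_trans s0; rewrite oppr_lt0.
have F_der s : 0 <= s <= t ->
    is_derive s (1 : R) (F p) ((- psi (S s) / (2 * S s)) *: F p s).
  move=> st; have n1 : (-1 : R) != 0 by rewrite oppr_eq0 oner_eq0.
  have s0 := S_gt0 (sI' s st).
   have [sT' sT] := sI s st.
  (* As |F(., s)|^2 is constant on the sphere, every point is both a maximum and a minimum. The two
     resulting inequalities fix the velocity. *)
  have ext : extremal R0 F 1 s p by move=> q qR; rewrite !radius_unique.
  have [c [dw [FE dwE dw_d le1]]] := extremal_speed gk_derive tangential_gt0 radial_gt0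
    m_gt0 R0_gt0 F_mcf pR sT' (oner_neq0 R) ext.
  have ext' : extremal R0 F (-1) s p by move=> q qR; rewrite !radius_unique.
  have [c' [dw' [_ _ dw_d' le2]]] := extremal_speed gk_derive tangential_gt0 radial_gt0
    m_gt0 R0_gt0 F_mcf pR sT' n1 ext'.
  have dwdw' : dw = dw' by have [_ <-] := dw_d; have [_ <-] := dw_d'.
  rewrite radius_unique // in dwE le1 le2.
  have {}dwE : 2 * (c * S s) = - psi (S s).
    by move: le1 le2 dwE; rewrite -dwdw'; lra.
  have -> : - psi (S s) / (2 * S s) = c by rewrite -dwE; field; rewrite gt_eqF.
  by rewrite -FE; exact: (flow_time_derive R0_gt0 F_mcf pR sT').
have sqrtS_gt0 s : 0 <= s <= t -> 0 < Num.sqrt (S s).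
  by move=> /sI' /S_gt0; rewrite sqrtr_gt0.
(* The coordinates of F/|F|, shown to have zero derivative in time. *)
pose y k (s : R) := F p s 0 k * (Num.sqrt (S s))^-1.
have y_der k s : 0 <= s <= t -> is_derive s (1 : R) (y k) 0.
  move=> st; have s0 := S_gt0 (sI' s st); have q0 := sqrtS_gt0 s st.
  have dS : is_derive s (1 : R) S (- psi (S s)).
    by apply: S_derive; have /andP[-> /lt_trans] := sI' s st; apply; rewrite ltrDl.
  have q_neq0 : Num.sqrt (S s) != 0 by rewrite gt_eqF.
  have Fk := (is_derive_rV _ _ _ _).1 (F_der s st) k.
  have dq := is_derive_invf (h := fun s => Num.sqrt (S s)) q_neq0 (is_derive_sqrtf s0 dS).
  rewrite /y; apply: is_derive_eq (is_derive_mul Fk dq) _.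
  rewrite mxE.
  have sE : S s = Num.sqrt (S s) ^+ 2 by rewrite sqr_sqrtr // ltW.
  have alg (P a q x : R) : q != 0 -> a = q ^+ 2 ->
    - P / (2 * a) * x * q^-1 + x * (-1 * (q^-1 * q^-1 * (2^-1 * q^-1 * - P))) = 0.
    by move=> qn ->; field; rewrite qn.
  exact: alg.
apply/rowP => k; rewrite mxE.
have [s _] := @MVT_segment R (y k) (fun=> 0) 0 t t0
  (fun s sI => y_der k s (subset_itv_oo_cc sI)) (continuous_in_subspaceT
  (fun s sI => is_derive_continuous (y_der k s (set_mem sI)))).
rewrite mul0r /y S0 F0 sqrtr_sqr gtr0_norm // => /eqP; rewrite subr_eq0 => /eqP yE.
have q0 : Num.sqrt (S t) != 0 by rewrite gt_eqF // sqrtS_gt0 // t0 lexx.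
by rewrite mulrAC -mulrA -yE mulrC divfK.
Qed.

(** A flow living beyond T would be nonzero at time T, whereas |F|^2 = S holds before T and, by
    continuity, would force |F|^2 = S(T) = 0. *)
Lemma lifespan_le : T' <= T.
Proof.
rewrite leNgt; apply/negP => TT'.
have T'0 : 0 <= T < T' by rewrite ltW.
have [p pR] := hypersphere_nonempty m_gt0 R0_gt0.
have wT : 0 < w p T.
  case: F_mcf => _ _ _ H _; have [q0 _] := H p T pR T'0.
  by rewrite radius2_gt0.
have dw := is_derive_radius2 (flow_time_derive R0_gt0 F_mcf pR T'0).
have TI : - d < T < T + d.
  by rewrite ltrDl d_gt0 andbT (lt_trans _ T_gt0) // oppr_lt0.
have c : {for T, continuous (fun t => w p t - S t)}.
  apply: continuousB; first exact: is_derive_continuous dw.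
  exact: is_derive_continuous (S_derive TI).
have : 0 < w p T - S T by rewrite ST subr0.
move=> /(continuous_near_gt c)/nbhs_ballP[e /= e0 eP].
pose r := Num.min e T / 2.
have m0 : 0 < Num.min e T by rewrite lt_min e0.
have rm : r < Num.min e T by rewrite /r; lra.
have r0 : 0 < r by rewrite divr_gt0.
have [re rT] : r < e /\ r < T by move: rm; rewrite lt_min => /andP[].
have : 0 < w p (T - r) - S (T - r).
  by apply: eP; rewrite /ball /= opprB addrCA subrr addr0 gtr0_norm.
rewrite radius_unique ?subrr ?ltxx //; last by lra.
by apply/andP; split; lra.
Qed.

End Comparison.

Theorem theorem5p4 (R : realType) (m : nat) (g : R -> R)
    (hm : (2 <= m)%N)
    (g_analytic : real_analytic_nonneg g)
    (gS0 : 0 < g^`()%classic 0)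
    (fS_gt0 : forall S : R, 0 < S -> 0 < S^-1 + g^`()%classic S)
    (SgSS_gt0 : forall S : R, 0 < S -> 0 < g^`()%classic S + S * g^`(2)%classic S) :
  let f := fun S : R => ln S + g S in
  exists2 eps : R, 0 < eps &
    forall R0 : R, 0 < R0 < eps ->
      exists (T : R) (F : 'rV[R]_(m + m) -> R -> 'rV[R]_(m + m)),
        [/\ mean_curvature_flow f R0 T F,
            (* F is the mean curvature flow starting from the hypersphere *)
            (forall (T' : R) (F' : 'rV[R]_(m + m) -> R -> 'rV[R]_(m + m)),
               mean_curvature_flow f R0 T' F' ->
               T' <= T /\
               forall p t, hypersphere R0 p -> 0 <= t < T' -> F' p t = F p t),
            converges_to_exceptional_divisor R0 T F,
            singular_time f R0 T F &
            type_I f R0 T F].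
Proof.
have m0 : (0 < m)%N by exact: leq_trans hm.
pose gk n := derive1n n g.
have gk_derive n (s : R) : 0 <= s ->
    \forall x \near s, is_derive x (1 : R) (gk n) (gk n.+1 x).
  move=> s0; apply: filterS (real_analytic_derivable n g_analytic s0) => x.
  exact: is_derive_derive1n.
have tan0 (x : R) : 0 < x -> 0 < tangential gk x.
  move=> x0; have -> : tangential gk x = x * (x^-1 + g^`()%classic x).
    by rewrite mulrDr mulfV ?gt_eqF.
  by rewrite mulr_gt0 // fS_gt0.
have rad0 (x : R) : 0 < x -> 0 < radial gk x := @SgSS_gt0 x.
have [c [k [l [L [c0 k0 l0 prof]]]]] := profile_bounds gk_derive gS0 m0.
(* The scalar equation starts from S(0) = R0^2, which must lie below c. *)
move=> f; exists (Num.sqrt c); first by rewrite sqrtr_gt0.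
move=> R0 /andP[R0_gt0 R0c].
have R02 : 0 < R0 ^+ 2 < c.
  rewrite exprn_gt0 //= -(sqr_sqrtr (ltW c0)).
  by rewrite ltr_sqr ?nnegrE ?sqrtr_ge0 // ltW.
have [|x xc|T [d [S [T0 d0 S0 ST [SP S_gt0]]]]] :=
    @scalar_flow R (shrinking_speed m gk) c (R0 ^+ 2) _ _ R02.
- by move=> x /prof[].
- by have [_ + _] := prof x xc; exact: lt_trans.
have S_derive t : - d < t < T + d ->
    is_derive t (1 : R) S (- shrinking_speed m gk (S t)) by move=> /SP[].
have S_lt t : - d < t < T + d -> `|S t| < c by move=> /SP[].
have prof' x : `|x| < c -> k < shrinking_speed m gk x /\ l < scaled_sff_norm2 m gk x < L.
  by move=> /prof[].
have psi0 t : - d < t < T + d -> 0 < shrinking_speed m gk (S t).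
  by move=> /S_lt/prof'[kp _]; exact: lt_trans kp.
exists T, (sphere_flow R0 S); split.
- exact: (sphere_flow_is_mcf gk_derive tan0 rad0 m0 R0_gt0 T0 d0 S0 S_derive S_gt0).
- move=> T' F' F'_mcf.
  have TT := lifespan_le gk_derive tan0 rad0 m0 R0_gt0 T0 d0 S0 ST S_derive
    psi0 F'_mcf.
  split=> // p t pR tI.
  apply: (flow_unique gk_derive tan0 rad0 m0 R0_gt0 T0 d0 S0 S_derive S_gt0
    psi0 F'_mcf pR tI).
  by case/andP: tI => _ /lt_le_trans; apply.
- exact: (sphere_flow_converges R0_gt0 T0 d0 ST S_derive S_gt0).
- exact: (sphere_flow_singular gk_derive tan0 rad0 m0 R0_gt0 T0 d0 ST S_derive S_gt0
    l0 S_lt prof').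
- exact: (sphere_flow_type_I gk_derive tan0 rad0 m0 R0_gt0 T0 d0 ST S_derive S_gt0
    k0 l0 S_lt prof').
Qed.
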